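(* Let $n\ge2$, let $\mathfrak{l}$ be a positive integer, let $p^{[1]},\dots,p^{[\mathfrak{l}]}$ be arbitrary distinct points on $\partial\mathbb{R}^n_+$, let $d$ be a constant with $0<d<\frac14\min_{1\le i\ne j\le\mathfrak{l}}|p^{[i]}-p^{[j]}|$ (no upper restriction if $\mathfrak{l}=1$), and let $N_0\in\mathbb{N}$. Then for all $T>0$ sufficiently small there exist functions $V_{p^{[i]},\mathbf m}(x,t)$, for $i=1,\dots,\mathfrak{l}$ and $\mathbf m\in\mathbb{N}^n$ with $\|\mathbf m\|_{\ell_1}\le N_0$, $m_n\in2\mathbb{N}$, solving $$\partial_tV_{p^{[i]},\mathbf m}=\Delta V_{p^{[i]},\mathbf m}\ \text{in }\mathbb{R}^n_+\times(0,T],\quad-\partial_{x_n}V_{p^{[i]},\mathbf m}=0\ \text{on }\partial\mathbb{R}^n_+\times(0,T],\quad V_{p^{[i]},\mathbf m}(x,0)=V_{p^{[i]},\mathbf m,0}(x)\ \text{in }\mathbb{R}^n_+,$$ with the following properties: (1) $V_{p^{[i]},\mathbf m,0}$ is smooth in $\overline{\mathbb{R}^n_+}$ and $V_{p^{[i]},\mathbf m,0}(x)=0$ in $\overline{\mathbb{R}^n_+\setminus B_n^+(p^{[i]},2d)}$. (2) $\partial_t^\iota D_x^{\mathbf k}V_{p^{[i]},\mathbf m}((\tilde x,0),t)=0$ for $\tilde x\in\mathbb{R}^{n-1}$, $t\in[0,T]$, $\iota\in\mathbb{N}$, $\mathbf k\in\mathbb{N}^n$ with $k_n\in2\mathbb{N}+1$.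 (3) $D_x^{\mathbf k}V_{p^{[i]},\mathbf m}(p^{[j]},T)=\delta_{\mathbf m,\mathbf k}\,\delta_{p^{[i]},p^{[j]}}$ for $\mathbf k\in\mathbb{N}^n$ with $\|\mathbf k\|_{\ell_1}\le N_0$ and $j=1,\dots,\mathfrak{l}$. (4) $\|\partial_t^\iota D_x^{\mathbf k}V_{p^{[i]},\mathbf m}\|_{L^\infty(\mathbb{R}^n_+\times[0,T])}\le C$ for $\iota\in\mathbb{N}$, $\mathbf k\in\mathbb{N}^n$ with $2\iota+\|\mathbf k\|_{\ell_1}\le N_0$, with a constant $C>0$ only depending on $\mathfrak{l},d,N_0,p^{[1]},\dots,p^{[\mathfrak{l}]}$.
   Context: $\mathbb{N}=\{0,1,\dots\}$; $2\mathbb{N}$ and $2\mathbb{N}+1$ are the even and odd natural numbers; $\mathbb{R}^n_+=\mathbb{R}^{n-1}\times(0,\infty)$, $x=(\tilde x,x_n)$; $B_n^+(q,r)=\{x\in\mathbb{R}^n:|x-q|<r\}\cap\mathbb{R}^n_+$. For a multi-index $\mathbf m=(m_1,\dots,m_n)\in\mathbb{N}^n$: $\|\mathbf m\|_{\ell_1}=\sum_i m_i$ and $D_x^{\mathbf m}=\partial_{x_1}^{m_1}\cdots\partial_{x_n}^{m_n}$. $\delta_{\cdot,\cdot}$ is the Kronecker delta. *)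

(* Defs.v *)
From HB Require Import structures.
From mathcomp Require Import all_boot all_order all_algebra.
From mathcomp Require Import all_classical all_reals all_analysis.

Set Implicit Arguments.
Unset Strict Implicit.
Unset Printing Implicit Defensive.

Import Order.TTheory GRing.Theory Num.Theory.
Import numFieldNormedType.Exports.

Local Open Scope classical_set_scope.
Local Open Scope ring_scope.

Section RelativeDerivatives.
Context {R : realType} {U : normedModType R}.
Implicit Types (D : set U) (f : U -> R) (a v : U).

(* Directional derivative of a function given on D: the difference quotient of
   the library's ['D_v f a], with the increments restricted to those that stay
   in D. It is ['D_v f a] at interior points of D ([derive_in_interior]) and
   the one-sided derivative at boundary points that v enters or leaves. *)
Definition quotient_in D f v a : set_system R :=
  (fun h : R => h^-1 *: (f (h *: v + a) - f a)) @
    within [set h : R | D (h *: v + a)] 0^'.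

Definition derive_in D v f a : R := lim (quotient_in D f v a).

Definition derivable_in D v f a : Prop := cvg (quotient_in D f v a).

(* C^oo on D, up to the boundary points in D: along the coordinate directions
   e, all iterated partial derivatives, in any order, exist and are continuous
   on D. *)
Definition smooth_in (I : Type) (e : I -> U) D f : Prop :=
  forall s : seq I,
    let g := foldr (fun i h => derive_in D (e i) h) f s in
    {within D, continuous g} /\
    (forall (i : I) (a : U), D a -> derivable_in D (e i) g a).

Lemma quotient_in_interior D f v a : D° a ->
  quotient_in D f v a =
  (fun h : R => h^-1 *: ((f \o shift a) (h *: v) - f a)) @ 0^'.
Proof.
move=> Da; rewrite /quotient_in; congr (_ @ _); apply/seteqP; split=> B /=.
  rewrite /within /= => HB.
  have HD : \forall h \near (0 : R)^', D (h *: v + a).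
    apply: nbhs_dnbhs.
    have cvD : (fun h : R => h *: v + a) @ (0 : R) --> a.
      rewrite -[X in _ --> X]add0r -(scale0r v).
      by apply: cvgD; [apply: cvgZr_tmp; exact: cvg_id | exact: cvg_cst].
    exact: cvD.
  by apply: filterS2 HB HD => h; exact.
by apply: filterS => h.
Qed.

Lemma derive_in_interior D f v a : D° a -> derive_in D v f a = 'D_v f a.
Proof. by move=> Da; rewrite /derive_in quotient_in_interior. Qed.

Lemma derivable_in_interior D f v a :
  D° a -> derivable_in D v f a <-> derivable f a v.
Proof. by move=> Da; rewrite /derivable_in quotient_in_interior. Qed.

Definition sup_norm (T : Type) (A : set T) (f : T -> R) : \bar R :=
  ereal_sup [set `|f z|%:E | z in A].

End RelativeDerivatives.

(* Points of R^N, N = n.+1, are row vectors; x_N is the coordinate [ord_max]. The library's norm on row vectors is the sup norm, so the Euclidean one is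
   defined here (both give the same topology). *)
Section HalfSpace.
Context {R : realType} {n : nat}.
Local Notation E := 'rV[R]_n.+1.
Implicit Types (x q : E) (V : E * R -> R).

Definition enorm x : R := Num.sqrt (\sum_i x 0 i ^+ 2).

Definition half_space : set E := [set x | 0 < x 0 ord_max].
Definition closed_half_space : set E := [set x | 0 <= x 0 ord_max].
Definition half_space_boundary : set E := [set x | x 0 ord_max = 0].

Definition half_ball q (r : R) : set E :=
  [set x | enorm (x - q) < r] `&` half_space.

Definition multi_index := {ffun 'I_n.+1 -> nat}.
Definition l1_norm (k : multi_index) : nat := (\sum_i k i)%N.

Definition unit_vec (i : 'I_n.+1) : E := delta_mx 0 i.

(* Coordinate directions of space-time: [None] is time. *)
Definition st_dir (o : option 'I_n.+1) : E * R :=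
  if o is Some i then (unit_vec i, 0) else (0, 1).

Definition cylinder (T : R) : set (E * R) := closed_half_space `*` `[0, T].

(* Below, T fixes the cylinder on which V lives. *)
Definition partial_t (T : R) V : E * R -> R :=
  derive_in (cylinder T) (st_dir None) V.

Definition partial_x (T : R) (i : 'I_n.+1) V : E * R -> R :=
  derive_in (cylinder T) (st_dir (Some i)) V.

Definition D_x (T : R) (k : multi_index) V : E * R -> R :=
  foldr (fun i W => iter (k i) (partial_x T i) W) V (enum 'I_n.+1).

Definition D_tx (T : R) (iota : nat) (k : multi_index) V : E * R -> R :=
  iter iota (partial_t T) (D_x T k V).

Definition laplacian (T : R) V (z : E * R) : R :=
  \sum_i partial_x T i (partial_x T i V) z.

Definition heat_neumann_solution (T : R) (V0 : E -> R) V : Prop :=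
  [/\ forall x t, half_space x -> 0 < t <= T ->
        partial_t T V (x, t) = laplacian T V (x, t),
      forall x t, half_space_boundary x -> 0 < t <= T ->
        - partial_x T ord_max V (x, t) = 0
    & forall x, half_space x -> V (x, 0) = V0 x].

End HalfSpace.

(* Main.v *)
(* The heat flow is taken in product form: if each f_a is a test function of one
   variable and P f (x, t) = E f(x + sqrt(2t) Z), with Z standard Gaussian, then
   prod_a P f_a (x_a, t) solves the heat equation. Every requirement factors
   through the coordinates, so it is enough to find, for a centre c, finitely
   many points b <> c and m <= N0, test functions f, depending on T but with
   derivatives bounded uniformly in T, such that the final state P f (., T) has
   jet (x - c)^m / m! at c and zero jet at each b, up to order N0.
   Gaussian integration by parts gives P_T ((x - b) f - 2 T f') = (x - b) P_T f:
   a final state may be multiplied by a polynomial while the support of the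
   initial datum stays fixed. Starting from a bump at c, multiplying by
   (x - b)^(N0+1) for each b and then by (x - c)^m gives final states that
   vanish to any prescribed order at the b's and exactly to order m at c; a
   triangular elimination of the higher derivatives at c yields the jets. *)
Require Import Defs.
From HB Require Import structures.
From mathcomp Require Import all_boot all_order all_algebra.
From mathcomp Require Import all_classical all_reals all_analysis.
From mathcomp Require Import measurable_realfun.
From mathcomp Require Import ring lra zify.
Import Order.TTheory GRing.Theory Num.Theory.
Import numFieldNormedType.Exports.
Set Implicit Arguments.
Unset Strict Implicit.
Unset Printing Implicit Defensive.
Local Open Scope classical_set_scope.
Local Open Scope ring_scope.

(** * Calculus on the line *)

Section Calculus.
Context {R : realType}.
Implicit Types (f g : R -> R) (x y z a b h l K M : R).

Lemma is_derive_eq_fun {f g : R -> R} {x : R} {df : R} :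
  is_derive x 1 f df -> f =1 g -> is_derive x 1 g df.
Proof. by move=> h /funext <-. Qed.

Lemma is_derive_continuous f (f' : R -> R) :
  (forall z : R, is_derive z (1 : R) f (f' z)) -> continuous f.
Proof.
move=> df z; apply: differentiable_continuous.
by apply/derivable1_diffP; have [] := df z.
Qed.

(** The mean value theorem is applied to [g - e * f] for both signs [e = 1] and [e = -1]. *)
Lemma compare_increments f (f' : R -> R) g (g' : R -> R) a b : a <= b ->
  (forall z : R, is_derive z 1 f (f' z)) -> (forall z : R, is_derive z 1 g (g' z)) ->
  (forall z, a <= z <= b -> `|f' z| <= g' z) ->
  `|f b - f a| <= g b - g a.
Proof.
move=> ab df dg fg.
have key e : `|e| = 1 -> e * (f b - f a) <= g b - g a.
  move=> e1.
  have dh (z : R) : z \in `]a, b[ ->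
      is_derive z 1 (fun w => g w - e * f w) (g' z - e * f' z).
    move=> _; have dfz := df z; have dgz := dg z.
    by apply: is_deriveB.
  have ch : {within `[a, b], continuous (fun w => g w - e * f w)}.
    apply: continuous_subspaceT => z.
    apply: cvgB; first exact: (is_derive_continuous dg).
    by apply: cvgM; [exact: cvg_cst | exact: (is_derive_continuous df)].
  have [c] := MVT_segment ab dh ch.
  rewrite in_itv /= => cab E.
  have : 0 <= g' c - e * f' c.
    rewrite subr_ge0; apply: le_trans (fg _ cab).
    by rewrite (le_trans (ler_norm _))// normrM e1 mul1r.
  have : 0 <= b - a by rewrite subr_ge0.
  by move=> h1 h2; have := mulr_ge0 h2 h1; lra.
by rewrite ler_norml lerNl -mulN1r -{2}[f b - f a]mul1r !key// ?normrN1 ?normr1.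
Qed.

Lemma lipschitz_of_derive f (f' : R -> R) M a b :
  (forall z : R, is_derive z 1 f (f' z)) -> (forall z, `|f' z| <= M) ->
  `|f b - f a| <= M * `|b - a|.
Proof.
move=> df fM.
wlog ab : a b / a <= b => [hw|].
  have [ab|/ltW ba] := leP a b; first exact: hw.
  by rewrite distrC (distrC b); exact: hw.
have dM (z : R) : is_derive z 1 (fun w : R => M * w) M.
  by apply: is_derive_eq; rewrite /GRing.scale /= mulr1.
have := compare_increments ab df dM (fun z _ => fM z).
by rewrite (@ger0_norm _ (b - a)) ?subr_ge0// mulrBr.
Qed.

(** On the segment, [f'] stays within [M * |h|] of [f' x], so [f w - w * f' x] is compared with a
    linear function of slope [M * |h|]. The constant loses a factor 2, which is harmless. *)
Lemma taylor_quadratic f (f' f'' : R -> R) M x h :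
  (forall z : R, is_derive z 1 f (f' z)) -> (forall z : R, is_derive z 1 f' (f'' z)) ->
  (forall z, `|f'' z| <= M) ->
  `|f (x + h) - f x - h * f' x| <= M * h ^+ 2.
Proof.
move=> df df' fM.
have M0 : 0 <= M by apply: le_trans (fM 0).
have dk (z : R) : is_derive z 1 (fun w => f w - w * f' x) (f' z - f' x).
  have dfz := df z; apply: is_derive_eq.
  by rewrite scaler0 add0r scaler1.
have dl (z : R) : is_derive z 1 (fun w : R => M * `|h| * w) (M * `|h|).
  by apply: is_derive_eq; rewrite /GRing.scale /= mulr1.
have bd z : `|z - x| <= `|h| -> `|f' z - f' x| <= M * `|h|.
  move=> zx; apply: le_trans (lipschitz_of_derive _ _ df' fM) _.
  by rewrite ler_wpM2l.
have [h0|/ltW h0] := leP 0 h.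
  have := @compare_increments _ _ _ _ x (x + h) _ dk dl.
  rewrite lerDl => /(_ h0).
  have -> : f (x + h) - (x + h) * f' x - (f x - x * f' x) =
    f (x + h) - f x - h * f' x by ring.
  rewrite -mulrBr (_ : x + h - x = h); last by ring.
  rewrite -mulrA => H.
  apply: le_trans (H _) _ => [z /andP[z1 z2]|].
    by apply: bd; rewrite !ger0_norm// ?subr_ge0//; lra.
  by rewrite ger0_norm// expr2.
have := @compare_increments _ _ _ _ (x + h) x _ dk dl.
rewrite gerDl => /(_ h0).
rewrite distrC.
have -> : f (x + h) - (x + h) * f' x - (f x - x * f' x) =
  f (x + h) - f x - h * f' x by ring.
rewrite -mulrBr (_ : x - (x + h) = - h); last by ring.
move=> H.
apply: le_trans (H _) _ => [z /andP[z1 z2]|].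
  by apply: bd; rewrite !ler0_norm// ?subr_le0//; lra.
by rewrite ler0_norm// -mulrA mulrNN expr2.
Qed.

(** A quadratic remainder with a uniform constant survives averaging; this is how differentiation
    passes under the Gaussian mean. *)
Lemma is_derive_quadratic f x l K :
  (forall h, `|h| <= 1 -> `|f (x + h) - f x - h * l| <= K * h ^+ 2) ->
  is_derive x 1 f l.
Proof.
move=> H.
suff : (fun h : R => h^-1 *: (f (h *: (1 : R) + x) - f x)) @ 0^' --> l.
  move=> cl; apply: DeriveDef; first by apply/cvg_ex; exists l.
  exact: cvg_lim cl.
have K0 : 0 <= K by have := H 1; rewrite normr1 expr1n mulr1 => /(_ (lexx _)); exact: le_trans.
apply/cvgrPdist_le => e e0.
near=> h.
have h0 : h != 0 by near: h; exact: nbhs_dnbhs_neq.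
have h1 : `|h| <= 1.
  by near: h; apply: dnbhs0_le.
have h2 : `|h| <= e / (K + 1).
  by near: h; apply: dnbhs0_le; rewrite divr_gt0// ltr_wpDl.
rewrite /GRing.scale /= mulr1 (addrC h).
have -> : l - h^-1 * (f (x + h) - f x) = - (h^-1 * (f (x + h) - f x - h * l)).
  by field.
rewrite normrN normrM normfV ler_pdivrMl ?normr_gt0//.
apply: le_trans (H _ h1) _.
rewrite -real_normK ?num_real// expr2 mulrA (mulrC `|h|) ler_pM2r ?normr_gt0//.
move: h2; rewrite ler_pdivlMr ?ltr_wpDl//; apply: le_trans.
by rewrite mulrDr mulr1 mulrC lerDl.
Unshelve. all: by end_near.
Qed.

End Calculus.

(** * Gaussian means *)

Section GaussianMean.
Context {R : realType}.
Implicit Types (f g h : R -> R) (x y z a b K M A : R).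
Local Notation mu := (@lebesgue_measure R).
Local Notation rho := (normal_pdf (0 : R) 1).

Definition gmean h : R := \int[mu]_z (h z * rho z).

(** The growth allowed here covers bounded functions, their products with [z], and the quadratic
    majorants of Taylor remainders. *)
Definition tame h : Prop :=
  continuous h /\ exists K, forall z, `|h z| <= K * (1 + z ^+ 2).

Lemma tame_cst a : tame (cst a).
Proof.
split; first by move=> z; exact: cvg_cst.
by exists `|a| => z; rewrite ler_peMr// lerDl sqr_ge0.
Qed.

Lemma tame_lin a b f g : tame f -> tame g -> tame (fun z => a * f z + b * g z).
Proof.
move=> [cf [K fK]] [cg [M gM]]; split.
  by move=> z; apply: cvgD; (apply: cvgM; first exact: cvg_cst); [exact: cf|exact: cg].
exists (`|a| * K + `|b| * M) => z.
rewrite mulrDl (le_trans (ler_normD _ _))// !normrM -!mulrA.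
by rewrite lerD// ler_wpM2l.
Qed.

Lemma rhoE z : rho z = normal_peak 1 * expR (- z ^+ 2 / 2).
Proof. by rewrite normal_pdfE ?oner_neq0// /normal_fun subr0 expr1n. Qed.

Lemma rho_sym z : rho (- z) = rho z.
Proof. by rewrite !rhoE sqrrN. Qed.

Lemma is_derive_rho z : is_derive z 1 rho (- z * rho z).
Proof.
have d1 : is_derive z 1 (fun w : R => normal_peak 1 * expR (- w ^+ 2 / 2))
   (normal_peak 1 * (- z * expR (- z ^+ 2 / 2))).
  have d2 : is_derive z 1 (fun w : R => - w ^+ 2 / 2) (- z).
    by apply: is_derive_eq; rewrite /GRing.scale /=; field.
  have d3 : is_derive z 1 (fun w : R => expR (- w ^+ 2 / 2))
      (- z * expR (- z ^+ 2 / 2)).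
    rewrite mulrC; exact: (is_derive1_comp _ d2).
  by apply: is_derive_eq; rewrite /GRing.scale /= ; ring.
rewrite rhoE (_ : - z * _ = normal_peak 1 * (- z * expR (- z ^+ 2 / 2))); last by ring.
by apply: is_derive_eq_fun d1 _ => w; rewrite rhoE.
Qed.

Lemma continuous_rho : continuous rho.
Proof. by apply: continuous_normal_pdf; rewrite oner_neq0. Qed.

Lemma integrable_quadratic :
  mu.-integrable setT (fun z => ((1 + z ^+ 2) * rho z)%:E).
Proof.
(* The majorant is the density of standard deviation 2: [1 + z ^+ 2 <= 4 * expR (3 / 8 * z ^+ 2)],
   and [3 / 8 = 1 / 2 - 1 / 8] is the gap between the two Gaussian exponents. *)
pose C : R := 4 * normal_peak 1 / normal_peak 2.
have p1 : 0 < normal_peak (1 : R) by rewrite normal_peak_gt0// oner_neq0.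
have p2 : 0 < normal_peak (2 : R) by rewrite normal_peak_gt0// pnatr_eq0.
apply: (@le_integrable _ _ _ mu setT measurableT _
  (fun z => (C%:E * (normal_pdf 0 2 z)%:E)%E)).
- apply/measurable_EFinP; apply: continuous_measurable_fun => z.
  apply: cvgM; last exact: continuous_rho.
  by apply: cvgD; [exact: cvg_cst|exact: exprn_continuous].
- move=> z _.
  have C0 : 0 <= C by rewrite /C divr_ge0// ?mulr_ge0// ltW.
  have z0 : 0 <= 1 + z ^+ 2 by rewrite addr_ge0// sqr_ge0.
  rewrite /= lee_fin normrM [X in _ <= X]normrM.
  rewrite (ger0_norm C0) (ger0_norm z0) !(ger0_norm (normal_pdf_ge0 _ _ _)).
  rewrite rhoE normal_pdfE ?pnatr_eq0// /normal_fun subr0 /C.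
  rewrite (_ : _ / _ * _ = normal_peak 1 * (4 * expR (- z ^+ 2 / (2 ^+ 2 *+ 2)))); last first.
    by field; rewrite gt_eqF.
  rewrite mulrCA ler_pM2l//.
  rewrite (_ : - z ^+ 2 / 2 = - z ^+ 2 / (2 ^+ 2 *+ 2) - 3 / 8 * z ^+ 2); last by field.
  rewrite expRD mulrCA [X in _ <= X]mulrC ler_pM2l ?expR_gt0//.
  rewrite expRN ler_pdivrMr ?expR_gt0//.
  have := expR_ge1Dx (3 / 8 * z ^+ 2); have := sqr_ge0 z; lra.
- exact: (integrableZl measurableT C (integrable_normal_pdf 0 2)).
Qed.

Lemma integrable_tame h : tame h ->
  mu.-integrable setT (EFin \o (fun z => h z * rho z)).
Proof.
move=> [ch [K hK]].
apply: (@le_integrable _ _ _ mu setT measurableT _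
  (fun z => (K%:E * ((1 + z ^+ 2) * rho z)%:E)%E)).
- apply/measurable_EFinP; apply: continuous_measurable_fun => z.
  by apply: cvgM; [exact: ch|exact: continuous_rho].
- move=> z _; rewrite /= lee_fin !normrM (ger0_norm (normal_pdf_ge0 _ _ _)).
  rewrite mulrA ler_wpM2r ?normal_pdf_ge0// -normrM.
  exact: le_trans (hK z) (ler_norm _).
- exact: (integrableZl measurableT K integrable_quadratic).
Qed.

Lemma gmean_lin a b f g : tame f -> tame g ->
  gmean (fun z => a * f z + b * g z) = a * gmean f + b * gmean g.
Proof.
move=> tf tg; have If := integrable_tame tf; have Ig := integrable_tame tg.
have IZ c h : tame h -> mu.-integrable setT (EFin \o (fun z => c * (h z * rho z))).
  by move=> th; exact: (integrableZl measurableT c (integrable_tame th)).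
rewrite /gmean -!RintegralZl// -RintegralD//; [|exact: IZ..].
by apply: eq_Rintegral => z _; rewrite mulrDl !mulrA.
Qed.

Lemma gmean_cst a : gmean (cst a) = a.
Proof.
rewrite /gmean RintegralZl//; last exact: integrable_normal_pdf.
by rewrite /Rintegral integral_normal_pdf mulr1.
Qed.

Lemma ler_norm_gmean h g : tame h -> tame g -> (forall z, `|h z| <= g z) ->
  `|gmean h| <= gmean g.
Proof.
move=> th tg hg; have Ih := integrable_tame th; have Ig := integrable_tame tg.
apply: le_trans (le_normr_Rintegral measurableT Ih) _.
apply: le_Rintegral => //; first exact: integrable_norm Ih.
move=> z _; rewrite normrM (ger0_norm (normal_pdf_ge0 _ _ _)).
by rewrite ler_wpM2r// normal_pdf_ge0.
Qed.

Lemma gmean_sym h : tame h -> gmean (fun z => h (- z)) = gmean h.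
Proof.
move=> th; rewrite /gmean /Rintegral; congr fine.
have If := integrable_tame th.
have Is : mu.-integrable setT (EFin \o (fun z => h (- z) * rho (- z))).
  under eq_fun do rewrite rho_sym.
  apply: (@integrable_tame (fun z => h (- z))); case: th => ch [K hK]; split.
    by move=> z; apply: (@continuous_comp _ _ _ -%R h); [exact: opp_continuous|exact: ch].
  by exists K => z; rewrite -(sqrrN z).
transitivity (\int[mu]_z (h (- z) * rho (- z))%:E)%E.
  by apply: eq_integral => z _; rewrite rho_sym.
have mN : measurable_fun setT (-%R : measurableTypeR R -> measurableTypeR R) by exact: oppr_measurable.
have := @integral_pushforward _ _ (measurableTypeR R) (measurableTypeR R) R _ mN
  (@lebesgue_measure R) setT (EFin \o (fun z => h z * rho z)).
rewrite preimage_setT => /(_ _ Is measurableT) /= <-; last by case/integrableP : If.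
by apply: eq_measure_integral => A mA _; exact: lebesgue_measureN.
Qed.

(** Stein's identity. Since [rho' = - z * rho], the difference of the two integrands is the
    derivative of [g * rho], whose integral over [[-A, A]] is zero because [g] vanishes at both
    ends. *)
Lemma gmean_stein g (g' : R -> R) A :
  (forall z : R, is_derive z 1 g (g' z)) -> continuous g' ->
  (forall z, A <= `|z| -> g z = 0) -> (forall z, A <= `|z| -> g' z = 0) ->
  gmean (fun z => z * g z) = gmean g'.
Proof.
move=> dg cg' g0 g'0.
wlog A0 : A g0 g'0 / 0 < A => [hw|].
  apply: (hw (Num.max A 1)); last by rewrite lt_max ltr01 orbT.
    by move=> z; rewrite ge_max => /andP[+ _]; exact: g0.
  by move=> z; rewrite ge_max => /andP[+ _]; exact: g'0.
pose k z : R := (g' z - z * g z) * rho z.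
have cg := is_derive_continuous dg.
have dF (z : R) : is_derive z 1 (fun w => g w * rho w) (k z).
  have dgz := dg z; have dr := is_derive_rho z.
  by apply: is_derive_eq; rewrite /GRing.scale /= /k; ring.
have ck : continuous k.
  move=> z; apply: cvgM; last exact: continuous_rho.
  apply: cvgB; first exact: cg'.
  by apply: cvgM; [exact: cvg_id|exact: cg].
have I0 : (\int[mu]_(z in `[(- A)%R, A]) (k z)%:E = 0)%E.
  have cF := is_derive_continuous dF.
  rewrite (@continuous_FTC2 _ k (fun w => g w * rho w)).
  - have nA : `|A| = A by rewrite ger0_norm// ltW.
    by rewrite (g0 A) ?nA// (g0 (- A)) ?normrN ?nA// !mul0r subee.
  - by rewrite gtrN.
  - exact: continuous_subspaceT.
  - split.
    + by move=> z _; have [] := dF z.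
    + by apply: cvg_at_right_filter; exact: cF.
    + by apply: cvg_at_left_filter; exact: cF.
  - by move=> z _; rewrite derive1E; have [_ ->] := dF z.
have k0 : gmean (fun z => g' z - z * g z) = 0.
  rewrite /gmean /Rintegral -[X in fine X](_ : (\int[mu]_(z in `[(- A)%R, A]) (k z)%:E)%E = _).
    by rewrite I0.
  rewrite [LHS]integral_mkcond; apply: eq_integral => z _; rewrite patchE.
  case: ifPn => // /negP; rewrite inE /= in_itv /= => Az.
  have {}Az : A <= `|z| by rewrite leNgt ltr_norml; apply/negP => /andP[h1 h2]; apply: Az; rewrite !ltW.
  by rewrite g0// g'0// mulr0 subrr mul0r.
have bounded_tame h : continuous h -> (forall z, A <= `|z| -> h z = 0) -> tame h.
  move=> ch h0; split => //.
  have AA : - A <= A by rewrite ge0_cp// ltW.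
  have cn : {within `[(- A), A], continuous (fun z => `|h z|)}.
    by apply: continuous_subspaceT => z; apply: cvg_norm; exact: ch.
  have [c _ hc] := EVT_max AA cn.
  exists `|h c| => z; apply: (@le_trans _ _ `|h c|).
    have [Az|/ltW] := leP A `|z|; first by rewrite h0// normr0.
    by rewrite ler_norml => Az; apply: hc; rewrite in_itv.
  by rewrite ler_peMr// lerDl sqr_ge0.
apply/esym/eqP; rewrite -subr_eq0 -[X in _ == X]k0; apply/eqP.
have t1 : tame g' by exact: bounded_tame.
have t2 : tame (fun z => z * g z).
  apply: bounded_tame => [z|z Az]; last by rewrite g0// mulr0.
  by apply: cvgM; [exact: cvg_id|exact: cg].
have := gmean_lin 1 (-1) t1 t2; rewrite mul1r mulN1r => <-.
by congr gmean; apply/funext => z; rewrite mul1r mulN1r.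
Qed.

End GaussianMean.

(** * The one-dimensional heat flow *)

Section Heat.
Context {R : realType}.
Implicit Types (f g : R -> R) (F G : nat -> R -> R) (x y z a b c r s t h M : R).

(** A test function supported in [[c - r, c + r]], given with all its derivatives as data, so that
    later derivatives are explicit formulas. *)
Definition cc_tower c r F : Prop :=
  (forall k x, is_derive x 1 (F k) (F k.+1 x)) /\
  (forall k x, r <= `|x - c| -> F k x = 0).

(* In the standard deviation [s] the mean is differentiable everywhere; in the
   time [t = s^2 / 2] only the one-sided derivative at [0] exists. *)
Definition smean f x s : R := gmean (fun z => f (x + s * z)).

Definition heat f x t : R := smean f x (Num.sqrt (2 * t)).

Lemma is_derive_affine f (f' : R -> R) x s z :
  (forall y, is_derive y 1 f (f' y)) ->
  is_derive z 1 (fun w => f (x + s * w)) (s * f' (x + s * z)).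
Proof.
move=> df; have dl : is_derive z 1 (fun w : R => x + s * w) s.
  by apply: is_derive_eq; rewrite add0r mul1r /GRing.scale /= mulr1.
rewrite mulrC; exact: (@is_derive1_comp _ f (fun w => x + s * w) z _ _ (df _) dl).
Qed.

Lemma ler_norm_1Dsqr z : `|z| <= 1 + z ^+ 2.
Proof.
by have := sqr_ge0 (`|z| - 1); have := sqr_ge0 z; rewrite -(real_normK (num_real z)); lra.
Qed.

Lemma tame_id : tame (fun z => z).
Proof.
split; first by move=> z; exact: cvg_id.
by exists 1 => z; rewrite mul1r ler_norm_1Dsqr.
Qed.

Lemma tame_quadratic a b : tame (fun z => a + b * z ^+ 2).
Proof.
split.
  move=> z; apply: cvgD; first exact: cvg_cst.
  by apply: cvgM; [exact: cvg_cst|exact: exprn_continuous].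
exists (`|a| + `|b|) => z; rewrite (le_trans (ler_normD _ _))// normrM.
rewrite (ger0_norm (sqr_ge0 z)) mulrDr mulr1 mulrDl.
have := normr_ge0 a; have := normr_ge0 b; have := sqr_ge0 z => h1 h2 h3.
by have := mulr_ge0 h3 h1; lra.
Qed.

Lemma smean0 f x : smean f x 0 = f x.
Proof.
rewrite /smean -[RHS]gmean_cst; congr gmean.
by apply/funext => z; rewrite mul0r addr0.
Qed.

Lemma gmeanB f g : tame f -> tame g ->
  gmean (fun z => f z - g z) = gmean f - gmean g.
Proof.
move=> tf tg; rewrite -[gmean f]mul1r -mulN1r -gmean_lin//.
by congr gmean; apply/funext => z; rewrite mul1r mulN1r.
Qed.

Lemma tameB f g : tame f -> tame g -> tame (fun z => f z - g z).
Proof.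
move=> tf tg; have := tame_lin 1 (-1) tf tg; congr tame.
by apply/funext => z; rewrite mul1r mulN1r.
Qed.

Lemma gmeanZ a f : tame f -> gmean (fun z => a * f z) = a * gmean f.
Proof.
move=> tf; rewrite -[RHS]addr0 -[X in _ + X](mul0r (gmean f)) -gmean_lin//.
by congr gmean; apply/funext => z; rewrite mul0r addr0.
Qed.

Lemma tameZ a f : tame f -> tame (fun z => a * f z).
Proof.
move=> tf; have := tame_lin a 0 tf tf; congr tame.
by apply/funext => z; rewrite mul0r addr0.
Qed.

Lemma gmean_id : gmean (fun z : R => z) = 0.
Proof.
have := gmean_sym tame_id.
rewrite (_ : (fun z => - z) = (fun z => -1 * z)); last by apply/funext => z; rewrite mulN1r.
by rewrite (gmeanZ _ tame_id) mulN1r => E; lra.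
Qed.

(** * Gaussian means of a test function: bounds, derivatives, heat equation *)

Section Tower.
Variables (c r : R) (F : nat -> R -> R).
Hypothesis tF : cc_tower c r F.

Lemma tower_derive k x : is_derive x 1 (F k) (F k.+1 x).
Proof. exact: tF.1. Qed.

Lemma tower_continuous k : continuous (F k).
Proof. exact: is_derive_continuous (tower_derive k). Qed.

Lemma tower_bounded k : exists M, forall x, `|F k x| <= M.
Proof.
have AA : c - `|r| <= c + `|r| by have := normr_ge0 r; lra.
have cn : {within `[c - `|r|, c + `|r|], continuous (fun z => `|F k z|)}.
  by apply: continuous_subspaceT => z; apply: cvg_norm; exact: tower_continuous.
have [m _ hm] := EVT_max AA cn.
exists `|F k m| => x.
have [rx|xr] := leP r `|x - c|; first by rewrite tF.2// normr0.
apply: hm; rewrite in_itv /=; move: xr; rewrite ltr_norml => /andP[h1 h2].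
by have := ler_norm r; lra.
Qed.

Lemma tame_tower k x s : tame (fun z => F k (x + s * z)).
Proof.
split.
  exact: is_derive_continuous (fun z => is_derive_affine x s z (tower_derive k)).
have [M FM] := tower_bounded k; exists M => z.
have M0 : 0 <= M by exact: le_trans (FM 0).
by rewrite (le_trans (FM _))// ler_peMr// lerDl sqr_ge0.
Qed.

Lemma tame_mul_tower k x s : tame (fun z => z * F k (x + s * z)).
Proof.
split.
  move=> z; apply: cvgM; first exact: cvg_id.
  exact: (tame_tower k x s).1.
have [M FM] := tower_bounded k; exists M => z.
have M0 : 0 <= M by exact: le_trans (FM 0).
rewrite normrM mulrC ler_pM//.
exact: ler_norm_1Dsqr.
Qed.

Lemma smean_bound k x s M : (forall y, `|F k y| <= M) -> `|smean (F k) x s| <= M.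
Proof.
move=> FM; rewrite -[leRHS]gmean_cst.
by apply: ler_norm_gmean => [||z]; [exact: tame_tower|exact: tame_cst|exact: FM].
Qed.

Lemma smean_dist k x x' s s' M : (forall y, `|F k.+1 y| <= M) ->
  `|smean (F k) x s - smean (F k) x' s'| <=
  M * (`|x - x'| + `|s - s'| * gmean (fun z : R => 1 + 1 * z ^+ 2)).
Proof.
move=> FM; have M0 : 0 <= M by exact: le_trans (FM 0).
have tq := tame_quadratic 1 1.
rewrite -gmeanB; [|exact: tame_tower..].
have E : M * (`|x - x'| + `|s - s'| * gmean (fun z : R => 1 + 1 * z ^+ 2)) =
   gmean (fun z => (M * `|x - x'|) * cst 1 z + (M * `|s - s'|) * (1 + 1 * z ^+ 2)).
  by rewrite gmean_lin ?gmean_cst//; [rewrite mulr1 -mulrA mulrDr | exact: tame_cst].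
rewrite E; apply: ler_norm_gmean => [||z].
- by apply: tameB; exact: tame_tower.
- by apply: tame_lin => //; exact: tame_cst.
- apply: le_trans (lipschitz_of_derive _ _ (tower_derive k) FM) _.
  rewrite mulr1 -mulrA -mulrDr ler_wpM2l//.
  have -> : x + s * z - (x' + s' * z) = (x - x') + (s - s') * z by ring.
  rewrite (le_trans (ler_normD _ _))// lerD2l normrM ler_wpM2l//.
  by rewrite mul1r ler_norm_1Dsqr.
Qed.

Lemma is_derive_smean_x k x s :
  is_derive x 1 (fun y => smean (F k) y s) (smean (F k.+1) x s).
Proof.
have [M FM] := tower_bounded k.+2.
apply: (@is_derive_quadratic _ _ _ _ M) => h _.
rewrite /smean -gmeanZ; last exact: tame_tower.
rewrite -!gmeanB; [| repeat (apply: tameB || apply: tameZ || apply: tame_tower)..].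
rewrite -[leRHS]gmean_cst.
apply: ler_norm_gmean => [||z].
- by repeat (apply: tameB || apply: tameZ || apply: tame_tower).
- exact: tame_cst.
- rewrite /cst (_ : x + h + s * z = x + s * z + h); last by ring.
  exact: taylor_quadratic (tower_derive k) (tower_derive k.+1) FM.
Qed.

(** Stein's identity for [z -> F k (x + s * z)], whose inner derivative produces the factor [s]. *)
Lemma smean_stein k x s :
  gmean (fun z => z * F k (x + s * z)) = s * smean (F k.+1) x s.
Proof.
have [->|s0] := eqVneq s 0.
  rewrite mul0r (_ : (fun _ => _) = (fun z => F k x * z)); last first.
    by apply/funext => z; rewrite mul0r addr0 mulrC.
  by rewrite (gmeanZ _ tame_id) gmean_id mulr0.
rewrite -gmeanZ; last exact: tame_tower.
(* For [|z| * |s| >= r + |x - c|] the point [x + s * z] is at distance at least [r] from [c]. *)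
apply: (@gmean_stein _ _ _ ((r + `|x - c|) / `|s|)).
- by move=> z; apply: is_derive_affine; exact: tower_derive.
- by move=> z; apply: cvgM; [exact: cvg_cst|exact: (tame_tower k.+1 x s).1].
- move=> z; rewrite ler_pdivrMr ?normr_gt0// => h1; apply: tF.2.
  have := ler_normB (x + s * z - c) (x - c).
  by rewrite (_ : _ - (x - c) = z * s) ?normrM; [lra | ring].
- move=> z; rewrite ler_pdivrMr ?normr_gt0// => h1; rewrite tF.2 ?mulr0//.
  have := ler_normB (x + s * z - c) (x - c).
  by rewrite (_ : _ - (x - c) = z * s) ?normrM; [lra | ring].
Qed.

(** Differentiation under the mean gives the mean of [z * F k.+1 (x + s * z)], which Stein's
    identity converts. This is the heat equation in the variable [s], with [t = s^2 / 2]. *)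
Lemma is_derive_smean_s k x s :
  is_derive s 1 (smean (F k) x) (s * smean (F k.+2) x s).
Proof.
have [M FM] := tower_bounded k.+2.
rewrite -smean_stein.
apply: (@is_derive_quadratic _ _ _ _ (M * gmean (fun z : R => 0 + 1 * z ^+ 2))) => h _.
have tq := tame_quadratic 0 1.
rewrite /smean -gmeanZ; last exact: tame_mul_tower.
rewrite -!gmeanB; [| repeat (apply: tameB || apply: tameZ || apply: tame_tower || apply: tame_mul_tower)..].
rewrite mulrAC -gmeanZ//.
apply: ler_norm_gmean => [||z].
- by repeat (apply: tameB || apply: tameZ || apply: tame_tower || apply: tame_mul_tower).
- exact: tameZ.
- have -> : x + (s + h) * z = x + s * z + h * z by ring.
  rewrite mulrA; apply: le_trans (taylor_quadratic _ _ (tower_derive k) (tower_derive k.+1) FM) _.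
  by rewrite add0r mul1r exprMn mulrA.
Qed.

Lemma smean_increment k x s s' M : (forall y, `|F k.+2 y| <= M) -> 0 <= s <= s' ->
  `|smean (F k) x s' - smean (F k) x s| <= M * (s' ^+ 2 - s ^+ 2) / 2.
Proof.
move=> FM /andP[s0 ss'].
have dg (z : R) : is_derive z 1 (fun w : R => M * w ^+ 2 / 2) (M * z).
  by apply: is_derive_eq; rewrite /GRing.scale /=; field.
have := compare_increments ss' (is_derive_smean_s k x) dg.
rewrite -mulrBl -mulrBr; apply => z /andP[sz _].
rewrite normrM (ger0_norm (le_trans s0 sz)) mulrC ler_wpM2r ?(le_trans s0)//.
exact: smean_bound.
Qed.

(** A Taylor estimate in the time [s ^+ 2 / 2], valid down to [s = 0]. After subtracting the linear
    part, the derivative at [w] is at most [M * D * w] by [smean_increment], and this is the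
    derivative of [M * D * (w ^+ 2 / 2)]. *)
Lemma smean_quadratic k x s s' M : (forall y, `|F k.+4 y| <= M) ->
  0 <= s -> 0 <= s' ->
  `|smean (F k) x s' - smean (F k) x s -
     (s' ^+ 2 - s ^+ 2) / 2 * smean (F k.+2) x s| <=
  M * ((s' ^+ 2 - s ^+ 2) / 2) ^+ 2.
Proof.
move=> FM s0 s'0.
have M0 : 0 <= M by exact: le_trans (FM 0).
pose m := smean (F k.+2) x s.
pose D := `|s' ^+ 2 - s ^+ 2| / 2.
have df (z : R) : is_derive z 1 (fun w => smean (F k) x w - w ^+ 2 / 2 * m)
    (z * (smean (F k.+2) x z - m)).
  have dz := is_derive_smean_s k x z.
  by apply: is_derive_eq; rewrite /GRing.scale /=; field.
have dg (z : R) : is_derive z 1 (fun w : R => M * D * (w ^+ 2 / 2)) (M * D * z).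
  by apply: is_derive_eq; rewrite /GRing.scale /=; field.
have bd z : 0 <= z -> `|smean (F k.+2) x z - m| <= M * D ->
    `|z * (smean (F k.+2) x z - m)| <= M * D * z.
  by move=> z0 H; rewrite normrM (ger0_norm z0) mulrC ler_wpM2r.
have Dsq : ((s' ^+ 2 - s ^+ 2) / 2) ^+ 2 = D * D.
  by rewrite -expr2 /D !exprMn real_normK ?num_real.
rewrite Dsq mulrA.
have [ss'|/ltW s's] := leP s s'.
  have DE : D = (s' ^+ 2 - s ^+ 2) / 2.
    by rewrite /D ger0_norm// subr_ge0 ler_sqr.
  have := compare_increments ss' df dg.
  rewrite -mulrBr -mulrBl -DE => H.
  rewrite DE in H *.
  rewrite (_ : _ - _ - _ = smean (F k) x s' - s' ^+ 2 / 2 * m - (smean (F k) x s - s ^+ 2 / 2 * m)); last by rewrite -/m; ring.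
  apply: H => z /andP[sz zs']; rewrite -DE; apply: bd; first exact: le_trans sz.
  apply: (le_trans (@smean_increment k.+2 x s z M FM _)); first by rewrite s0.
  rewrite -mulrA ler_wpM2l// DE ler_pM2r ?invr_gt0// lerD2r ler_sqr// nnegrE.
  exact: le_trans sz.
have DE : D = (s ^+ 2 - s' ^+ 2) / 2.
  by rewrite /D ler0_norm ?opprB// subr_le0 ler_sqr.
have := compare_increments s's df dg.
rewrite -mulrBr -mulrBl -DE => H.
rewrite DE in H *.
rewrite distrC (_ : _ - (_ - _) = smean (F k) x s - s ^+ 2 / 2 * m - (smean (F k) x s' - s' ^+ 2 / 2 * m)); last by rewrite -/m; ring.
apply: H => z /andP[sz zs']; rewrite -DE; apply: bd; first exact: le_trans sz.
rewrite distrC.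
apply: (le_trans (@smean_increment k.+2 x z s M FM _)); first by rewrite zs' andbT; exact: le_trans sz.
rewrite -mulrA ler_wpM2l// DE ler_pM2r ?invr_gt0// lerD2l lerN2 ler_sqr// nnegrE.
exact: le_trans sz.
Qed.

(** * The same facts in the time variable *)

Lemma heat_bound k x t M : (forall y, `|F k y| <= M) -> `|heat (F k) x t| <= M.
Proof. exact: smean_bound. Qed.

Lemma heat0 f x : heat f x 0 = f x.
Proof. by rewrite /heat mulr0 sqrtr0 smean0. Qed.

Lemma is_derive_heat_x k x t :
  is_derive x 1 (fun y => heat (F k) y t) (heat (F k.+1) x t).
Proof. exact: is_derive_smean_x. Qed.

Lemma heat_quadratic_t k x t h M : (forall y, `|F k.+4 y| <= M) ->
  0 <= t -> 0 <= t + h ->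
  `|heat (F k) x (t + h) - heat (F k) x t - h * heat (F k.+2) x t| <= M * h ^+ 2.
Proof.
move=> FM t0 th0; have := smean_quadratic x FM (sqrtr_ge0 (2 * t)) (sqrtr_ge0 (2 * (t + h))).
rewrite !sqr_sqrtr ?mulr_ge0//.
by rewrite (_ : (2 * (t + h) - 2 * t) / 2 = h)//; field.
Qed.

Lemma heat_dist_t k x t M : (forall y, `|F k.+2 y| <= M) -> 0 <= t ->
  `|heat (F k) x t - F k x| <= M * t.
Proof.
move=> FM t0; rewrite -[F k x]smean0.
have := @smean_increment k x 0 (Num.sqrt (2 * t)) M FM.
rewrite lexx sqrtr_ge0 => /(_ isT); rewrite sqr_sqrtr ?mulr_ge0// expr0n /= subr0.
by rewrite (_ : M * (2 * t) / 2 = M * t)//; field.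
Qed.

(** [Num.sqrt] is continuous on the whole line and zero on negative numbers, so the flow is frozen
    at its datum for negative times and continuity holds on the whole plane. *)
Lemma continuous_heat k : continuous (fun p : R * R => heat (F k) p.1 p.2).
Proof.
have [M FM] := tower_bounded k.+1.
have M0 : 0 <= M by exact: le_trans (FM 0).
set q := gmean (fun z : R => 1 + 1 * z ^+ 2).
move=> [x t]; apply/cvgrPdist_le => e e0.
have c1 : (fun p : R * R => M * (`|x - p.1| + `|Num.sqrt (2 * t) - Num.sqrt (2 * p.2)| * q)) @ (x, t) --> (0 : R).
  have -> : 0 = M * (`|x - x| + `|Num.sqrt (2 * t) - Num.sqrt (2 * t)| * q).
    by rewrite !subrr normr0 mul0r addr0 mulr0.
  apply: cvgM; first exact: cvg_cst.
  apply: cvgD.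
    by apply: cvg_norm; apply: cvgB; [exact: cvg_cst|exact: cvg_fst].
  apply: cvgM; last exact: cvg_cst.
  apply: cvg_norm; apply: cvgB; first exact: cvg_cst.
  apply: (@cvg_comp _ _ _ (fun p : R * R => 2 * p.2) Num.sqrt _ (nbhs (2 * t))).
    by apply: cvgM; [exact: cvg_cst|exact: cvg_snd].
  exact: sqrt_continuous.
near=> p; apply: (@le_trans _ _ (M * (`|x - p.1| + `|Num.sqrt (2 * t) - Num.sqrt (2 * p.2)| * q))).
  exact: smean_dist.
apply: le_trans (ler_norm _) _; rewrite -normrN -[X in `|X|]sub0r.
near: p; move/cvgrPdist_le : c1; exact.
Unshelve. all: by end_near.
Qed.

(** Under the mean, [y - b] splits as [(x - b) + s * z]; Stein's identity turns the second part into
    [s ^+ 2 = 2 * t] times the mean of the derivative. *)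
Lemma heat_mulX k x t b : 0 <= t ->
  heat (fun y => (y - b) * F k y) x t =
  (x - b) * heat (F k) x t + 2 * t * heat (F k.+1) x t.
Proof.
move=> t0; rewrite -[2 * t]sqr_sqrtr ?mulr_ge0// /heat.
set s := Num.sqrt _; rewrite expr2 -mulrA -smean_stein -gmean_lin.
- by congr gmean; apply/funext => z; ring.
- exact: tame_tower.
- exact: tame_mul_tower.
Qed.

Lemma heat_reflect k x t b : heat (fun y => F k (b - y)) x t = heat (F k) (b - x) t.
Proof.
rewrite /heat /smean -[RHS]gmean_sym; last exact: tame_tower.
by congr gmean; apply/funext => z; congr (F k _); ring.
Qed.

End Tower.

End Heat.

(** * A bump function *)

Section Bump.
Context {R : realType}.
Implicit Types (F G : nat -> R -> R) (p : {poly R}) (x y c r : R) (k : nat).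

(** Each monomial is controlled by the exponential series: [y ^+ n <= n! * expR y] for [y >= 0]. *)
Lemma poly_expRN_bounded p :
  exists2 K, 0 <= K & forall y, 0 <= y -> `|p.[y] * expR (- y)| <= K.
Proof.
elim/poly_ind: p => [|p a [K K0 IH]].
  by exists 0 => // y _; rewrite horner0 mul0r normr0.
have [L L0 HL] : exists2 L, 0 <= L &
    forall (n : nat) y, (n < size p)%N -> 0 <= y -> `|p`_n * y ^+ n.+1 * expR (- y)| <= L.
  exists (\sum_(i < size p) `|p`_i| * (i.+1)`!%:R).
    by apply: sumr_ge0 => i _; rewrite mulr_ge0.
  move=> n y np y0; rewrite (bigD1 (Ordinal np))//=.
  apply: ler_wpDr; first by apply: sumr_ge0 => i _; rewrite mulr_ge0.
  rewrite -mulrA normrM ler_wpM2l// ger0_norm ?mulr_ge0 ?exprn_ge0 ?expR_ge0//.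
  rewrite expRN ler_pdivrMr ?expR_gt0// mulrC -ler_pdivrMr ?ltr0n ?fact_gt0//.
  by have := expR_ge1Dxn n y0; lra.
exists (L *+ size p + `|a|); first by rewrite addr_ge0// mulrn_wge0.
move=> y y0; rewrite hornerMXaddC mulrDl (le_trans (ler_normD _ _))//.
apply: lerD.
  rewrite horner_coef mulr_suml mulr_suml (le_trans (ler_norm_sum _ _ _))//.
  rewrite -[X in _ <= _ *+ X]card_ord -sumr_const ler_sum// => i _.
  by rewrite -(mulrA _ _ y) -exprSr HL.
rewrite normrM ler_piMr// ger0_norm ?expR_ge0//.
by rewrite -expR0 ler_expR oppr_le0.
Qed.

(** The [k]-th derivative of [expR (- x^-1)] on the positive axis is [P_k(1/x) * expR (- x^-1)]; the
    recursion is the chain rule with [y = 1/x], [y' = - y^2]. *)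
Fixpoint flat_poly k : {poly R} :=
  if k is j.+1 then 'X^2 * (flat_poly j - (flat_poly j)^`()) else 1.

Definition flat k x : R :=
  if 0 < x then (flat_poly k).[x^-1] * expR (- x^-1) else 0.

Lemma is_derive_flat k x : is_derive x 1 (flat k) (flat k.+1 x).
Proof.
rewrite /(flat k.+1 x); have [x0|] := ltP 0 x.
  have dV : is_derive x 1 (fun y : R => y^-1) (- x ^- 2).
    apply: is_derive_eq; first by apply: is_deriveV; rewrite gt_eqF.
    by rewrite /GRing.scale /= mulr1.
  have d1 := is_derive1_comp (is_derive_poly (flat_poly k) x^-1) dV.
  have dN : is_derive x 1 (fun y : R => - y^-1) (x ^- 2).
    by apply: is_derive_eq; rewrite opprK.
  have d2 := @is_derive1_comp _ expR (fun y : R => - y^-1) x _ _ (is_derive_expR _) dN.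
  have d3 : is_derive x 1 (fun y : R => (flat_poly k).[y^-1] * expR (- y^-1))
     ((flat_poly k.+1).[x^-1] * expR (- x^-1)).
    apply: (is_derive_eq (is_deriveM d1 d2)).
    rewrite /= !hornerE /GRing.scale /= exprVn; ring.
  apply: near_eq_is_derive d3; near=> y.
  rewrite /flat ifT//=.
  by near: y; exact: (lt_nbhsr x0).
rewrite le_eqVlt => /predU1P[->|x0].
  (* The extra ['X^2] gives [|flat k h| <= K * h ^+ 2], hence derivative zero at the origin. *)
  have [K K0 HK] := poly_expRN_bounded ('X^2 * flat_poly k).
  apply: (@is_derive_quadratic _ _ _ _ K) => h _.
  rewrite add0r mulr0 subr0 /flat ltxx subr0.
  case: ifPn => h0; last by rewrite normr0 mulr_ge0// sqr_ge0.
  have := HK h^-1; rewrite invr_ge0 => /(_ (ltW h0)).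
  rewrite !hornerE -mulrA normrM exprVn (@ger0_norm _ (h ^+ 2)^-1) ?invr_ge0 ?sqr_ge0//.
  by rewrite ler_pdivrMl ?exprn_gt0// => H; apply: (le_trans H); rewrite mulrC expr2 mulrA.
have d0 : is_derive x 1 (cst 0 : R -> R) 0 by exact: is_derive_cst.
apply: near_eq_is_derive d0; near=> y.
rewrite /flat ifF//; apply/negbTE; rewrite -leNgt ltW//.
by near: y; exact: (lt_nbhsl x0).
Unshelve. all: by end_near.
Qed.

(** Leibniz's rule as a binary recursion, which avoids binomial coefficients. *)
Fixpoint mul_tower k F G x : R :=
  if k is j.+1 then mul_tower j (fun i => F i.+1) G x + mul_tower j F (fun i => G i.+1) x
  else F 0%N x * G 0%N x.

Lemma is_derive_mul_tower k F G x :
  (forall i x, is_derive x 1 (F i) (F i.+1 x)) ->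
  (forall i x, is_derive x 1 (G i) (G i.+1 x)) ->
  is_derive x 1 (mul_tower k F G) (mul_tower k.+1 F G x).
Proof.
elim: k F G => [|k IH] F G dF dG.
  have d1 := dF 0%N x; have d2 := dG 0%N x.
  apply: (is_derive_eq (is_deriveM d1 d2)).
  by rewrite /= /GRing.scale /= addrC mulrC.
by apply: is_deriveD; apply: IH.
Qed.

Lemma mul_tower_eq0 k F G x :
  (forall i, F i x = 0) \/ (forall i, G i x = 0) -> mul_tower k F G x = 0.
Proof.
elim: k F G => [|k IH] F G /= H.
  by case: H => ->; rewrite ?mul0r ?mulr0.
by rewrite !IH ?addr0//; case: H => H; [left|right|left|right].
Qed.

Lemma exists_bump c r : 0 < r -> exists2 F, cc_tower c r F & 0 < F 0%N c.
Proof.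
move=> r0.
(* [A] lives on [x > c - r] and [B] on [x < c + r]. The factors [1] give both the shape required by
   [daff]. *)
pose A k x := 1 ^+ k * flat k (r - c + 1 * x).
pose B k x := (-1) ^+ k * flat k (r + c + -1 * x).
exists (fun k => mul_tower k A B); last first.
  rewrite /= /A /B !expr0 !mul1r mulN1r addrK subrK /flat r0 /=.
  by rewrite !hornerE !mulr_gt0 ?expR_gt0.
have daff (e a : R) k x : is_derive x 1 (fun y => e ^+ k * flat k (a + e * y))
    (e ^+ k.+1 * flat k.+1 (a + e * x)).
  have d := is_derive_affine a e x (is_derive_flat k).
  by apply: is_derive_eq; rewrite /GRing.scale /= exprS; ring.
split=> [k x|k x rx]; first by apply: is_derive_mul_tower => i y; exact: daff.
apply: mul_tower_eq0; rewrite /A /B /flat.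
move: rx; case: (ger0P (x - c)) => x0 rx.
  by right => i; rewrite ifF ?mulr0//; apply/negbTE; rewrite -leNgt; lra.
by left => i; rewrite ifF ?mulr0//; apply/negbTE; rewrite -leNgt; lra.
Qed.

End Bump.

(** * One-dimensional data with prescribed final jets *)

Section Families.
Context {R : realType}.
Implicit Types (F G : nat -> R -> R) (Phi Psi : R -> nat -> R -> R).
Implicit Types (x y a b c r s t T M e : R) (bs : seq R).

(** Merges finitely many constants into one; monotonicity lets the maximum replace each of them. *)
Lemma exists_uniform_bound (A : eqType) (Q : A -> R -> Prop) (u : seq A) :
  (forall i x y, x <= y -> Q i x -> Q i y) ->
  (forall i, i \in u -> exists M, Q i M) -> exists M, forall i, i \in u -> Q i M.
Proof.
move=> Qle; elim: u => [|i u IH] H; first by exists 0.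
have [M HM] := H i (mem_head _ _).
have [|K HK] := IH; first by move=> j ju; apply: H; rewrite inE ju orbT.
exists (Num.max M K) => j; rewrite inE => /predU1P[->|ju].
  by apply: Qle HM; rewrite le_max lexx.
by apply: Qle (HK _ ju); rewrite le_max lexx orbT.
Qed.

Lemma heat_lin c r c' r' F G a b k j x t :
  cc_tower c r F -> cc_tower c' r' G ->
  heat (fun y => a * F k y + b * G j y) x t = a * heat (F k) x t + b * heat (G j) x t.
Proof.
by move=> tF tG; rewrite /heat /smean gmean_lin//; [exact: tame_tower tF _ _ _ | exact: tame_tower tG _ _ _].
Qed.

Definition lin_tower a b F G k x : R := a * F k x + b * G k x.

Lemma lin_tower_cc c r a b F G :
  cc_tower c r F -> cc_tower c r G -> cc_tower c r (lin_tower a b F G).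
Proof.
move=> [dF F0] [dG G0]; split=> [k x|k x rx].
  have d1 := dF k x; have d2 := dG k x.
  by apply: is_derive_eq; rewrite /GRing.scale.
by rewrite /lin_tower F0// G0// !mulr0 addr0.
Qed.

(* The derivatives of [(x - b) f - 2 T f']: flowing up to time [T] turns this
   operator into the multiplication by [x - b]. *)
Definition mulX_tower b T F k x : R :=
  (x - b) * F k x + k%:R * F k.-1 x - 2 * T * F k.+1 x.

Lemma mulX_tower_cc c r b T F :
  cc_tower c r F -> cc_tower c r (mulX_tower b T F).
Proof.
move=> [dF F0]; split=> [k x|k x rx]; last first.
  by rewrite /mulX_tower !F0// !mulr0 addr0 subr0.
have d1 := dF k x; have d2 := dF k.-1 x; have d3 := dF k.+1 x.
apply: is_derive_eq; rewrite /GRing.scale /= /mulX_tower.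
by case: k {d1 d2 d3} => [|k] /=; rewrite ?[in RHS]natr1 -?natr1; ring.
Qed.

(** The term [- 2 * T * F k.+1] cancels the Stein term of [heat_mulX], leaving the [k]-th derivative
    of [x - b] times the final state. At [k = 0] the value of [k.-1] is harmless, its coefficient
    being zero. *)
Lemma heat_mulX_tower c r b T F k x : cc_tower c r F -> 0 <= T ->
  heat (mulX_tower b T F k) x T =
  (x - b) * heat (F k) x T + k%:R * heat (F k.-1) x T.
Proof.
move=> tF T0; apply/eqP; rewrite -(subr_eq0) opprD addrA; apply/eqP.
have := heat_mulX tF k x b T0.
rewrite /heat; set s := Num.sqrt _; rewrite /smean => E.
have tX : tame (fun z => (x + s * z - b) * F k (x + s * z)).
  rewrite (_ : (fun _ => _) = (fun z => (x - b) * F k (x + s * z) + s * (z * F k (x + s * z)))).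
    by apply: tame_lin; [exact: tame_tower tF _ _ _|exact: tame_mul_tower tF _ _ _].
  by apply/funext => z; ring.
have t1 := tame_tower tF k.-1 x s; have t2 := tame_tower tF k.+1 x s.
have t3 := tame_lin 1 k%:R tX t1.
rewrite (_ : (fun z => mulX_tower b T F k (x + s * z)) =
  fun z => 1 * (1 * ((x + s * z - b) * F k (x + s * z)) + k%:R * F k.-1 (x + s * z)) +
    (- (2 * T)) * F k.+1 (x + s * z)); last first.
  by apply/funext => z; rewrite /mulX_tower; ring.
rewrite (gmean_lin _ _ t3 t2) (gmean_lin _ _ tX t1) E; ring.
Qed.

(** The average of the function and its reflection about [c]. The flow preserves evenness about [c],
    so odd derivatives vanish there at all times; in the normal coordinate this is the Neumann
    condition. *)
Definition sym_tower c F k x : R := 2^-1 * F k x + 2^-1 * ((-1) ^+ k * F k (2 * c - x)).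

Lemma reflect_tower_cc c r F :
  cc_tower c r F -> cc_tower c r (fun k x => (-1) ^+ k * F k (2 * c - x)).
Proof.
move=> [dF F0]; split=> [k x|k x rx]; last first.
  by rewrite F0 ?mulr0// (_ : _ - c = - (x - c)) ?normrN//; ring.
have d := is_derive_affine (2 * c) (-1) x (dF k).
have d' : is_derive x 1 (fun w => F k (2 * c - w)) (-1 * F k.+1 (2 * c - x)).
  rewrite -(mulN1r x); apply: is_derive_eq_fun d _ => w; by rewrite mulN1r.
by apply: is_derive_eq; rewrite /GRing.scale /= exprS; ring.
Qed.

Lemma sym_tower_cc c r F : cc_tower c r F -> cc_tower c r (sym_tower c F).
Proof. by move=> tF; apply: lin_tower_cc => //; exact: reflect_tower_cc. Qed.

Lemma heat_sym_tower c r F k t : cc_tower c r F ->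
  heat (sym_tower c F k) c t = if odd k then 0 else heat (F k) c t.
Proof.
move=> tF; have tF' := reflect_tower_cc tF.
rewrite (heat_lin _ _ k k c t tF tF').
rewrite (_ : heat (fun x => (-1) ^+ k * F k (2 * c - x)) c t = (-1) ^+ k * heat (F k) c t).
  by rewrite -signr_odd; case: odd; rewrite ?expr1 ?expr0; field.
have t1 := tame_tower tF k.
rewrite /heat /smean.
have t2 : tame (fun z => F k (2 * c - (c + Num.sqrt (2 * t) * z))).
  have := t1 c (- Num.sqrt (2 * t)); congr tame.
  by apply/funext => z; congr (F k _); ring.
rewrite gmeanZ//; congr (_ * _).
have := heat_reflect tF k c t (2 * c); rewrite /heat /smean => ->.
by congr gmean; apply/funext => z; congr (F k _); ring.
Qed.

(** * Families indexed by the final time [T], and elimination of their jets at one centre *)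

Section OnePoint.
Variables (c r T0 : R).
Hypothesis T01 : T0 <= 1.

(** The datum may depend on [T], but its support interval and derivative bounds may not. *)
Definition good_family Phi : Prop :=
  (forall T, 0 < T < T0 -> cc_tower c r (Phi T)) /\
  (forall k, exists M, forall T x, 0 < T < T0 -> `|Phi T k x| <= M).

Definition jet Phi T k x : R := heat (Phi T k) x T.

Lemma good_lin Phi Psi (f g : R -> R) :
  good_family Phi -> good_family Psi ->
  (exists M, forall T, 0 < T < T0 -> `|f T| <= M) ->
  (exists M, forall T, 0 < T < T0 -> `|g T| <= M) ->
  good_family (fun T => lin_tower (f T) (g T) (Phi T) (Psi T)).
Proof.
move=> [tP bP] [tQ bQ] [A fA] [B gB]; split=> [T T0T|k].
  by apply: lin_tower_cc; [exact: tP|exact: tQ].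
have [M PM] := bP k; have [K QK] := bQ k.
exists (A * M + B * K) => T x hT.
rewrite (le_trans (ler_normD _ _))// !normrM.
by rewrite lerD// ler_pM// ?fA ?gB ?PM ?QK.
Qed.

Lemma jet_lin Phi Psi (f g : R -> R) T k x :
  good_family Phi -> good_family Psi -> 0 < T < T0 ->
  jet (fun T => lin_tower (f T) (g T) (Phi T) (Psi T)) T k x =
  f T * jet Phi T k x + g T * jet Psi T k x.
Proof. by move=> [tP _] [tQ _] hT; rewrite /jet (heat_lin _ _ _ _ _ _ (tP _ hT) (tQ _ hT)). Qed.

Lemma jet_bounded Phi k x : good_family Phi ->
  exists M, forall T, 0 < T < T0 -> `|jet Phi T k x| <= M.
Proof.
move=> [tP bP]; have [M PM] := bP k; exists M => T hT.
by apply: (heat_bound (tP _ hT)) => y; exact: PM.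
Qed.

Lemma good_mulX b Phi : good_family Phi ->
  good_family (fun T => mulX_tower b T (Phi T)).
Proof.
move=> [tP bP]; split=> [T hT|k]; first by apply: mulX_tower_cc; exact: tP.
have [M PM] := bP k; have [K PK] := bP k.-1; have [L PL] := bP k.+1.
(* On the support [|x - b| <= |r| + |c - b|], and [2 * T <= 2] since [T < T0 <= 1]. *)
exists ((`|r| + `|c - b|) * M + k%:R * K + 2 * L) => T x hT.
have T1 : `|2 * T| <= 2.
  move: hT => /andP[/ltW T1 T2]; rewrite ger0_norm ?mulr_ge0//.
  by have := T01; lra.
have L0 : 0 <= L by exact: le_trans (PL T x hT).
have M0 : 0 <= M by exact: le_trans (PM T x hT).
rewrite /mulX_tower; apply: le_trans (ler_normB _ _) _.
apply: le_trans (lerD (ler_normD _ _) (lexx _)) _.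
apply: lerD; [apply: lerD|]; rewrite normrM.
- have [rx|rx] := leP r `|x - c|.
    by rewrite (tP _ hT).2// normr0 mulr0 mulr_ge0// addr_ge0.
  apply: ler_pM; rewrite ?PM//.
  rewrite (_ : x - b = (x - c) + (c - b)); last by ring.
  apply: le_trans (ler_normD _ _) _; rewrite lerD2r.
  exact: le_trans (ltW rx) (ler_norm _).
- by rewrite (ger0_norm (ler0n R k)) ler_wpM2l// PK.
- by rewrite ler_pM// PL.
Qed.

Lemma jet_mulX b Phi T k x : good_family Phi -> 0 < T < T0 ->
  jet (fun T => mulX_tower b T (Phi T)) T k x =
  (x - b) * jet Phi T k x + k%:R * jet Phi T k.-1 x.
Proof.
move=> [tP _] hT; rewrite /jet (heat_mulX_tower _ _ _ (tP _ hT))//.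
by move: hT => /andP[/ltW].
Qed.

Lemma jet_mulX_eq0 b Phi T x (q : nat) : good_family Phi -> 0 < T < T0 ->
  (forall k, (k < q)%N -> jet Phi T k x = 0) ->
  forall k, (k < q)%N -> jet (fun T => mulX_tower b T (Phi T)) T k x = 0.
Proof.
move=> gP hT H k kq; rewrite jet_mulX// !H ?mulr0 ?addr0//.
exact: leq_ltn_trans (leq_pred k) kq.
Qed.

(** At [b] only [k] times the derivative of order [k - 1] remains, so the order of vanishing goes up
    by one. *)
Lemma jet_mulX_self b Phi T (q : nat) : good_family Phi -> 0 < T < T0 ->
  (forall k, (k < q)%N -> jet Phi T k b = 0) ->
  forall k, (k < q.+1)%N -> jet (fun T => mulX_tower b T (Phi T)) T k b = 0.
Proof.
move=> gP hT H k kq; rewrite jet_mulX// subrr mul0r add0r.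
by case: k kq => [|k] kq; [rewrite mul0r | rewrite H ?mulr0].
Qed.

(** The lower bound [e] is uniform in [T], so that dividing by the leading derivative at [c]
    preserves uniform bounds. *)
Definition vanishing_family (q : nat) bs (m : nat) Phi : Prop :=
  [/\ good_family Phi,
   exists2 e, 0 < e & forall T, 0 < T < T0 -> e <= `|jet Phi T m c|,
   forall T k, 0 < T < T0 -> (k < m)%N -> jet Phi T k c = 0 &
   forall T b k, 0 < T < T0 -> b \in bs -> (k < q)%N -> jet Phi T k b = 0].

Lemma exists_vanishing_family0 (q : nat) bs Phi :
  vanishing_family 0 [::] 0 Phi -> (forall b, b \in bs -> b != c) ->
  exists Psi, vanishing_family q bs 0 Psi.
Proof.
move=> H0; elim: bs => [|b bs IH] bc.
  by case: H0 => h1 h2 h3 h4; exists Phi; split.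
have [|Psi HPsi] := IH; first by move=> b' b's; apply: bc; rewrite inE b's orbT.
suff [Psi' [hP H]] : exists Psi', vanishing_family q bs 0 Psi' /\
    forall T k, 0 < T < T0 -> (k < q)%N -> jet Psi' T k b = 0.
  exists Psi'; case: hP => h1 h2 h3 h4; split => // T b' k hT.
  by rewrite inE => /predU1P[->|b's] kq; [exact: H|exact: h4].
(* Here [j] counts the factors [x - b] applied so far; each one multiplies the lower bound at [c] by
   [|c - b|] and keeps the zeros already obtained. *)
suff : forall j, exists Psi', vanishing_family q bs 0 Psi' /\
    forall T k, 0 < T < T0 -> (k < j)%N -> jet Psi' T k b = 0 by exact.
elim=> [|j [Psi' [[h1 [e e0 h2] h3 h4] h5]]]; first by exists Psi.
exists (fun T => mulX_tower b T (Psi' T)); split; last first.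
  by move=> T k hT; apply: jet_mulX_self => // i; exact: h5.
split=> [||//|T b' k hT b's].
- exact: good_mulX.
- exists (`|c - b| * e).
    by rewrite mulr_gt0// normr_gt0 subr_eq0 eq_sym bc// mem_head.
  by move=> T hT; rewrite jet_mulX// mul0r addr0 normrM ler_wpM2l// h2.
- by apply: jet_mulX_eq0 => // i; exact: h4.
Qed.

(** Each factor [x - c] multiplies the leading derivative at [c] by [m + 1 >= 1], so the lower bound
    [e] persists. *)
Lemma exists_vanishing_family (q m : nat) bs Phi :
  vanishing_family q bs 0 Phi -> exists Psi, vanishing_family q bs m Psi.
Proof.
move=> H0; elim: m => [|m [Psi [h1 [e e0 h2] h3 h4]]]; first by exists Phi.
exists (fun T => mulX_tower c T (Psi T)); split=> [||T k hT|T b k hT bb].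
- exact: good_mulX.
- exists e => // T hT; rewrite jet_mulX// subrr mul0r add0r /= normrM.
  by rewrite (le_trans (h2 _ hT))// ler_peMl// normr_nat ler1n.
- by apply: jet_mulX_self => // i; exact: h3.
- by apply: jet_mulX_eq0 => // i; exact: h4.
Qed.

Lemma exists_jet_family (q m : nat) bs :
  (forall j, exists Psi, vanishing_family q bs j Psi) ->
  exists Phi, [/\ good_family Phi,
   forall T k, 0 < T < T0 -> (k < q)%N -> jet Phi T k c = (k == m)%:R &
   forall T b k, 0 < T < T0 -> b \in bs -> (k < q)%N -> jet Phi T k b = 0].
Proof.
move=> HV.
(* At stage [j] the derivatives at [c] of order at most [m + j] are correct; stage [q] covers all
   orders below [q]. *)
suff : forall j, exists Phi, [/\ good_family Phi,
   forall T k, 0 < T < T0 -> (k < m.+1 + j)%N -> jet Phi T k c = (k == m)%:R &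
   forall T b k, 0 < T < T0 -> b \in bs -> (k < q)%N -> jet Phi T k b = 0].
  move=> /(_ q)[Phi [h1 h2 h3]]; exists Phi; split=> // T k hT kq.
  by apply: h2 => //; rewrite (leq_trans kq)// leq_addl.
have inv_bound Psi k : vanishing_family q bs k Psi ->
    exists M, forall T, 0 < T < T0 -> `|(jet Psi T k c)^-1| <= M.
  move=> [_ [e e0 h] _ _]; exists e^-1 => T hT.
  by rewrite normfV lef_pV2 ?h// posrE// (lt_le_trans e0)// h.
have jet_neq0 Psi k T : vanishing_family q bs k Psi -> 0 < T < T0 -> jet Psi T k c != 0.
  by move=> [_ [e e0 h] _ _] hT; rewrite -normr_gt0 (lt_le_trans e0)// h.
elim=> [|j [Phi [h1 h2 h3]]].
  have [Psi HPsi] := HV m; have [M HM] := inv_bound _ _ HPsi.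
  have [g1 _ g3 g4] := HPsi.
  have bnd0 : exists M, forall T, 0 < T < T0 -> `|0 : R| <= M.
    by exists 0 => T _; rewrite normr0.
  exists (fun T => lin_tower (jet Psi T m c)^-1 0 (Psi T) (Psi T)); split.
  - by apply: (@good_lin _ _ (fun T => (jet Psi T m c)^-1) (fun=> 0)) => //; exists M.
  - move=> T k hT; rewrite (@jet_lin _ _ (fun T => (jet Psi T m c)^-1) (fun=> 0))//.
    rewrite addn0 ltnS leq_eqVlt mul0r addr0 => /predU1P[->|km].
      by rewrite eqxx mulVf// (jet_neq0 _ _ _ HPsi).
    by rewrite (g3 T k)// mulr0 ltn_eqF.
  - move=> T b k hT bb kq; rewrite (@jet_lin _ _ (fun T => (jet Psi T m c)^-1) (fun=> 0))//.
    by rewrite (g4 T b k)// !mulr0 addr0.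
pose n := (m.+1 + j)%N.
have [Psi HPsi] := HV n; have [M HM] := inv_bound _ _ HPsi.
have [g1 _ g3 g4] := HPsi.
(* [Psi] vanishes at [c] exactly to order [n], so adding this multiple clears the derivative of
   order [n] and leaves the lower ones alone. *)
pose f T := - jet Phi T n c * (jet Psi T n c)^-1.
have bnd1 : exists M, forall T, 0 < T < T0 -> `|1 : R| <= M.
  by exists 1 => T _; rewrite normr1.
exists (fun T => lin_tower 1 (f T) (Phi T) (Psi T)); split.
- apply: (@good_lin _ _ (fun=> 1) f) => //.
  have [K HK] := jet_bounded n c h1.
  by exists (K * M) => T hT; rewrite normrM normrN ler_pM ?HK ?HM.
- move=> T k hT; rewrite (@jet_lin _ _ (fun=> 1) f)// addnS ltnS leq_eqVlt mul1r.
  move=> /predU1P[->|kn]; last by rewrite h2// (g3 T k)// mulr0 addr0.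
  rewrite -/n /f mulNr mulNr divfK ?(jet_neq0 _ _ _ HPsi)// subrr.
  by rewrite gtn_eqF// /n addSn ltnS leq_addr.
- move=> T b k hT bb kq; rewrite (@jet_lin _ _ (fun=> 1) f)//.
  by rewrite h3// (g4 T b k)// !mulr0 addr0.
Qed.

End OnePoint.

Lemma exists_base_family c r : 0 < r ->
  exists T0 Phi, [/\ 0 < T0, T0 <= 1 & vanishing_family c r T0 0 [::] 0 Phi].
Proof.
move=> r0; have [F tF F0] := exists_bump c r0.
have [M FM] := tower_bounded tF 2.
have M0 : 0 <= M by exact: le_trans (FM 0).
(* By [heat_dist_t] the value at [c] moves by at most [M * T <= F 0 c / 2], hence stays above
   [F 0 c / 2]. Using [M + 1] keeps the denominator positive. *)
pose T0 := Num.min 1 (F 0%N c / 2 / (M + 1)).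
exists T0, (fun=> F); split.
- by rewrite lt_min ltr01 !divr_gt0// ltr_wpDl.
- by rewrite ge_min lexx.
- split=> //; first split=> // k.
    by have [K FK] := tower_bounded tF k; exists K => T x _.
  exists (F 0%N c / 2); first by rewrite divr_gt0.
  move=> T /andP[T1]; rewrite lt_min => /andP[_ T2]; rewrite /jet.
  have := heat_dist_t tF (k := 0) c FM (ltW T1).
  have : M * T <= F 0%N c / 2.
    move: T2; rewrite ltr_pdivlMr ?ltr_wpDl// => /ltW; apply: le_trans.
    by rewrite mulrC ler_wpM2l ?(ltW T1)// lerDl.
  rewrite ler_distl => h1 /andP[h2 _].
  by apply: le_trans (ler_norm _); lra.
Qed.

(** The last clause is meant for the normal coordinate, where all centres coincide and the order [m]
    is even. *)
Lemma exists_one_dim_data c r bs (N : nat) : 0 < r ->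
  (forall b, b \in bs -> b != c) ->
  exists T0 C : R, 0 < T0 /\ forall T (m : nat), 0 < T < T0 -> (m <= N)%N ->
    exists F, [/\ cc_tower c r F,
      forall k x, (k <= N)%N -> `|F k x| <= C,
      forall k, (k <= N)%N -> heat (F k) c T = (k == m)%:R,
      forall b k, b \in bs -> (k <= N)%N -> heat (F k) b T = 0 &
      bs = [::] -> ~~ odd m -> forall k t, odd k -> heat (F k) c t = 0].
Proof.
move=> r0 bsc.
have [T0 [Phi0 [T00 T01 H0]]] := exists_base_family c r0.
have [Phi1 H1] := exists_vanishing_family0 T01 N.+1 H0 bsc.
have H2 m := exists_jet_family m (fun j => exists_vanishing_family T01 j H1).
pose Q (m : nat) C := forall T, 0 < T < T0 -> exists F, [/\ cc_tower c r F,
      forall k x, (k <= N)%N -> `|F k x| <= C,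
      forall k, (k <= N)%N -> heat (F k) c T = (k == m)%:R,
      forall b k, b \in bs -> (k <= N)%N -> heat (F k) b T = 0 &
      bs = [::] -> ~~ odd m -> forall k t, odd k -> heat (F k) c t = 0].
have [| |C HC] := @exists_uniform_bound _ Q (iota 0 N.+1); last first.
- exists T0, C; split=> // T m hT mN; apply: HC => //.
  by rewrite mem_iota.
- move=> m _; have [Phi [[tP bP] h1 h2]] := H2 m.
  have [| |C HC] := @exists_uniform_bound _
     (fun k M => forall T x, 0 < T < T0 -> `|Phi T k x| <= M) (iota 0 N.+1).
  + by move=> k x y xy H T z hT; apply: le_trans xy; exact: H.
  + by move=> k _; exact: bP.
  have {}HC T k x : 0 < T < T0 -> (k <= N)%N -> `|Phi T k x| <= C.
    by move=> hT kN; apply: HC => //; rewrite mem_iota.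
  exists C => T hT; have tF := tP _ hT.
  (* Reflection would move the zero jets from [b] to [2 * c - b], so symmetrization is done only
     without other centres. For even [m] it agrees with the prescribed jet, whose odd entries are
     zero. *)
  have [bs0|bs0] := eqVneq bs [::]; last first.
    exists (Phi T); split=> //.
    + by move=> k x kN; exact: HC.
    + by move=> k kN; exact: h1.
    + by move=> b k bb kN; exact: h2.
    + by move=> E; rewrite E in bs0.
  have [om|em] := boolP (odd m).
    exists (Phi T); split=> //.
    + by move=> k x kN; exact: HC.
    + by move=> k kN; exact: h1.
    + by move=> b k bb kN; exact: h2.
  exists (sym_tower c (Phi T)); split.
  + exact: sym_tower_cc.
  + move=> k x kN; rewrite (le_trans (ler_normD _ _))// !normrM normrX normrN1 expr1n mul1r.
    have := HC T k x hT kN; have := HC T k (2 * c - x) hT kN.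
    by rewrite (@ger0_norm _ 2^-1) ?invr_ge0//; lra.
  + move=> k kN; rewrite (heat_sym_tower _ _ tF); case: ifPn => [ok|_].
      by rewrite (_ : (k == m) = false)//; apply/negbTE/eqP => km; rewrite -km ok in em.
    exact: h1.
  + by rewrite bs0.
  + by move=> _ _ k t ok; rewrite (heat_sym_tower _ _ tF) ok.
- move=> m x y xy H T hT; have [F [g1 g2 g3 g4 g5]] := H T hT.
  by exists F; split=> // k z kN; apply: le_trans xy; exact: g2.
Qed.

End Families.

(** * Difference quotients relative to a set *)

Section Rate.
Context {R : realType}.
Implicit Types (H : set R) (f g : R -> R) (l h K : R).

(* A quadratic remainder, over the increments in [H] only, covers the one-sided
   derivatives at both ends of [[0, T]]. *)
Definition rate H f l : Prop :=
  exists K, forall h, H h -> `|h| <= 1 -> `|f h - f 0 - h * l| <= K * h ^+ 2.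

Lemma rate_ge0 H f l : rate H f l ->
  exists2 K, 0 <= K & forall h, H h -> `|h| <= 1 -> `|f h - f 0 - h * l| <= K * h ^+ 2.
Proof.
move=> [K HK]; exists `|K| => // h Hh h1.
by apply: le_trans (HK h Hh h1) _; rewrite ler_wpM2r ?sqr_ge0 ?ler_norm.
Qed.

Lemma eq_rate H f g l : (forall h, H h -> f h = g h) -> f 0 = g 0 ->
  rate H f l -> rate H g l.
Proof.
by move=> fg fg0 [K HK]; exists K => h Hh h1; rewrite -fg// -fg0; exact: HK.
Qed.

Lemma rate_cst H a : rate H (fun=> a) 0.
Proof. by exists 0 => h _ _; rewrite subrr mulr0 subr0 normr0 mul0r. Qed.

Lemma rateD H f g l m : rate H f l -> rate H g m -> rate H (fun h => f h + g h) (l + m).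
Proof.
move=> [K HK] [M HM]; exists (K + M) => h Hh h1.
rewrite (_ : _ - _ = (f h - f 0 - h * l) + (g h - g 0 - h * m)); last by ring.
by rewrite mulrDl (le_trans (ler_normD _ _))// lerD ?HK ?HM.
Qed.

Lemma rateM H f g l m : rate H f l -> rate H g m ->
  rate H (fun h => f h * g h) (l * g 0 + f 0 * m).
Proof.
move=> /rate_ge0[K K0 HK] /rate_ge0[M M0 HM].
exists (K * (`|g 0| + `|m| + M) + (`|f 0| + `|l|) * M + `|l| * `|m|) => h Hh h1.
have h2 : h ^+ 2 <= 1 by rewrite -real_normK ?num_real// expr_le1.
have h0 := sqr_ge0 h.
set p := f h - f 0 - h * l; set q := g h - g 0 - h * m.
have gh : g h = q + (g 0 + h * m) by rewrite /q; ring.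
(* Product of the expansions [f 0 + h * l + p] and [g 0 + h * m + q]; each remaining term is of
   order [h ^+ 2]. *)
rewrite (_ : _ - _ = p * g h + (f 0 + h * l) * q + h ^+ 2 * (l * m)); last first.
  by rewrite /p /q; ring.
have pK : `|p| <= K * h ^+ 2 by exact: HK.
have qM : `|q| <= M * h ^+ 2 by exact: HM.
have hx y : `|h * y| <= `|y| by rewrite normrM ler_piMl.
have ghB : `|g h| <= `|g 0| + `|m| + M.
  rewrite gh (le_trans (ler_normD _ _))// addrC lerD//.
    by rewrite (le_trans (ler_normD _ _))// lerD2l.
  by rewrite (le_trans qM)// ler_piMr.
have fhB : `|f 0 + h * l| <= `|f 0| + `|l|.
  by rewrite (le_trans (ler_normD _ _))// lerD2l.
rewrite [leRHS](_ : _ = K * h ^+ 2 * (`|g 0| + `|m| + M) +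
  (`|f 0| + `|l|) * (M * h ^+ 2) + h ^+ 2 * (`|l| * `|m|)); last by ring.
apply: le_trans (ler_normD _ _) _; apply: lerD.
  apply: le_trans (ler_normD _ _) _.
  by rewrite !normrM; apply: lerD; apply: ler_pM.
by rewrite normrM (ger0_norm h0) normrM.
Qed.

Lemma rate_sum (I : eqType) (r : seq I) H (F : I -> R -> R) (l : I -> R) :
  (forall i, rate H (F i) (l i)) ->
  rate H (fun h => \sum_(i <- r) F i h) (\sum_(i <- r) l i).
Proof.
move=> HF; elim: r => [|i r IH].
  rewrite big_nil; apply: eq_rate (rate_cst H 0) => [h _|]; by rewrite big_nil.
rewrite big_cons; apply: eq_rate (rateD (HF i) IH) => [h _|]; by rewrite big_cons.
Qed.

Lemma rate_prod (I : eqType) (r : seq I) H (F : I -> R -> R) (l : I -> R) :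
  uniq r -> (forall i, rate H (F i) (l i)) ->
  rate H (fun h => \prod_(i <- r) F i h)
    (\sum_(j <- r) \prod_(i <- r) (if i == j then l i else F i 0)).
Proof.
move=> + HF; elim: r => [_|i r IH /= /andP[ir ur]].
  rewrite big_nil; apply: eq_rate (rate_cst H 1) => [h _|]; by rewrite big_nil.
have := rateM (HF i) (IH ur).
set L := (X in rate _ _ X -> _).
suff -> : L = \sum_(j <- i :: r) \prod_(k <- i :: r) (if k == j then l k else F k 0).
  by apply: eq_rate => [h _|]; rewrite big_cons.
rewrite big_cons big_cons eqxx; congr (_ * _ + _).
  apply: eq_big_seq => k kr; rewrite ifF//.
  by apply: contraNF ir => /eqP <-.
rewrite mulr_sumr; apply: eq_big_seq => j jr; rewrite big_cons ifF//.
by apply: contraNF ir => /eqP ->.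
Qed.

End Rate.

(** * From rates to relative derivatives and smoothness *)

Section DeriveIn.
Context {R : realType} {U : normedModType R}.
Implicit Types (D : set U) (f g : U -> R) (a v : U) (l : R).

Lemma rate_quotient_in D f v a l :
  rate [set h | D (h *: v + a)] (fun h => f (h *: v + a)) l ->
  quotient_in D f v a --> l.
Proof.
move=> /rate_ge0[K K0 HK]; apply/cvgrPdist_le => e e0; rewrite near_withinE /=.
near=> h => Dh.
have h0 : h != 0 by near: h; exact: nbhs_dnbhs_neq.
have h1 : `|h| <= 1 by near: h; apply: dnbhs0_le.
have h2 : `|h| <= e / (K + 1).
  by near: h; apply: dnbhs0_le; rewrite divr_gt0// ltr_wpDl.
have := HK h Dh h1; rewrite scale0r add0r => H.
rewrite /GRing.scale /=.
rewrite (_ : l - _ = - (h^-1 * (f (h *: v + a) - f a - h * l))); last by field.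
rewrite normrN normrM normfV ler_pdivrMl ?normr_gt0//.
apply: le_trans H _.
rewrite -real_normK ?num_real// expr2 mulrA (mulrC `|h|) ler_pM2r ?normr_gt0//.
move: h2; rewrite ler_pdivlMr ?ltr_wpDl//; apply: le_trans.
by rewrite mulrDr mulr1 mulrC lerDl.
Unshelve. all: by end_near.
Qed.

(** Arbitrarily small admissible increments make the restricted filter proper, so the limit is
    unique. Agreement of [f] and [g] on [D] suffices, which lets iterated derivatives be replaced by
    closed formulas known on [D] only. *)
Lemma derive_in_rate D f g v a l :
  (forall e, 0 < e -> exists h : R, [/\ h != 0, `|h| < e & D (h *: v + a)]) ->
  (forall b, D b -> f b = g b) -> D a ->
  rate [set h | D (h *: v + a)] (fun h => g (h *: v + a)) l ->
  derivable_in D v f a /\ derive_in D v f a = l.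
Proof.
move=> Da0 fg Da gl.
have {}gl : rate [set h | D (h *: v + a)] (fun h => f (h *: v + a)) l.
  by apply: eq_rate gl => [h Dh|]; rewrite fg//= scale0r add0r.
have cf := rate_quotient_in gl; split; first by apply/cvg_ex; exists l.
have PF : ProperFilter (within [set h | D (h *: v + a)] 0^').
  split; last exact: within_filter.
  rewrite /within /= /dnbhs /within /= => /nbhs_ballP[e /= e0 He].
  have [h [h0 he Dh]] := Da0 e e0.
  by apply: (He h) => //; rewrite /ball /= sub0r normrN.
by apply: cvg_lim cf.
Qed.

Lemma smooth_in_closed_class (I : Type) (e : I -> U) D (C : (U -> R) -> Prop) f :
  (forall g, C g -> continuous g) ->
  (forall g i, C g -> exists2 g', C g' &
     forall f a, (forall b, D b -> f b = g b) -> D a ->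
       derivable_in D (e i) f a /\ derive_in D (e i) f a = g' a) ->
  C f -> smooth_in e D f.
Proof.
move=> Cc Cd Cf s /=.
have [g Cg Hg] : exists2 g, C g &
    forall a, D a -> foldr (fun i h => derive_in D (e i) h) f s a = g a.
  elim: s => [|i s [g Cg IH]] /=; first by exists f.
  have [g' Cg' H] := Cd g i Cg; exists g' => // a Da.
  by have [_ ->] := H _ a IH Da.
split.
  apply: (@subspace_eq_continuous _ _ _ g) => [a|].
    by rewrite inE => Da; symmetry; exact: Hg.
  by apply: continuous_subspaceT; exact: Cc.
move=> i a Da; have [g' _ H] := Cd g i Cg.
by have [] := H _ a Hg Da.
Qed.

End DeriveIn.

(** * Products of one-dimensional heat flows *)

Lemma continuous_big_sum {R : realType} {U : topologicalType} {I : Type} (u : seq I)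
    (f : I -> U -> R) : (forall i, continuous (f i)) ->
  continuous (fun z => \sum_(i <- u) f i z).
Proof.
move=> cf; elim: u => [|i u IH].
  rewrite (_ : (fun _ => _) = cst 0); first by move=> z; exact: cvg_cst.
  by apply/funext => z; rewrite big_nil.
rewrite (_ : (fun _ => _) = (fun z => f i z + \sum_(j <- u) f j z)); last first.
  by apply/funext => z; rewrite big_cons.
by move=> z; apply: cvgD; [exact: cf|exact: IH].
Qed.

Lemma continuous_big_prod {R : realType} {U : topologicalType} {I : Type} (u : seq I)
    (f : I -> U -> R) : (forall i, continuous (f i)) ->
  continuous (fun z => \prod_(i <- u) f i z).
Proof.
move=> cf; elim: u => [|i u IH].
  rewrite (_ : (fun _ => _) = cst 1); first by move=> z; exact: cvg_cst.
  by apply/funext => z; rewrite big_nil.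
rewrite (_ : (fun _ => _) = (fun z => f i z * \prod_(j <- u) f j z)); last first.
  by apply/funext => z; rewrite big_cons.
by move=> z; apply: cvgM; [exact: cf|exact: IH].
Qed.

Section HeatProduct.
Context {R : realType} {n : nat}.
Local Notation E := 'rV[R]_n.+1.
Local Notation index := (@multi_index n).
Implicit Types (x y : E) (t h T : R) (z : E * R) (kappa k : index) (s : seq index).

Variables (q : 'I_n.+1 -> R) (r : R) (F : 'I_n.+1 -> nat -> R -> R).
Hypothesis tF : forall a, cc_tower (q a) r (F a).

Definition shift_index d kappa (i : 'I_n.+1) : index :=
  [ffun a => kappa a + d * (a == i)]%N.

Definition heat_prod kappa z : R := \prod_a heat (F a (kappa a)) (z.1 0 a) z.2.

(* Finite sums of products, listed by the orders of differentiation of their factors. *)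
Definition heat_sum s z : R := \sum_(kappa <- s) heat_prod kappa z.

Definition dx_list i s := [seq shift_index 1 kappa i | kappa <- s].
(** The time derivative of a factor is its second space derivative, so Leibniz's rule raises one
    order by 2, for each coordinate in turn. *)
Definition dt_list s := [seq shift_index 2 kappa i | kappa <- s, i <- enum 'I_n.+1].

Lemma heat_sum1 kappa : heat_sum [:: kappa] = heat_prod kappa.
Proof. by apply/funext => z; rewrite /heat_sum big_seq1. Qed.

Lemma shift_prod kappa (i : 'I_n.+1) d (x : E) t :
  \prod_a (if a == i then heat (F a (kappa a + d)) (x 0 a) t
           else heat (F a (kappa a)) (x 0 a) t) =
  heat_prod (shift_index d kappa i) (x, t).
Proof.
apply: eq_bigr => a _; rewrite ffunE.
by case: eqP => _; rewrite ?muln1 ?muln0 ?addn0.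
Qed.

(** Only the factor [i] moves with [h]; the others have rate zero, and one term of the Leibniz sum
    survives. *)
Lemma rate_heat_sum_x (H : set R) i s x t :
  rate H (fun h => heat_sum s (h *: unit_vec i + x, t)) (heat_sum (dx_list i s) (x, t)).
Proof.
rewrite /heat_sum big_map; apply: rate_sum => kappa.
pose phi (a : 'I_n.+1) h := heat (F a (kappa a)) ((h *: unit_vec i + x) 0 a) t.
pose l a := (a == i)%:R * heat (F a (kappa a).+1) (x 0 a) t.
have rl a : rate H (phi a) (l a).
  rewrite /phi /l; have [->|ai] := eqVneq a i; last first.
    rewrite mul0r; apply: eq_rate (rate_cst H (heat (F a (kappa a)) (x 0 a) t)) => [h _|];
      by rewrite !mxE (negbTE ai) mulr0 add0r.
  have [M FM] := tower_bounded (tF i) (kappa i).+2.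
  exists M => h _ _; rewrite !mxE !eqxx mulr1 mul0r add0r mul1r (addrC h).
  have d j (w : R) : is_derive w 1 (fun w => heat (F i j) w t) (heat (F i j.+1) w t).
    exact: (is_derive_heat_x (tF i)).
  have hM w : `|heat (F i (kappa i).+2) w t| <= M by exact: (heat_bound (tF i)).
  exact: (taylor_quadratic (x 0 i) h (d _) (d _) hM).
have := rate_prod (index_enum_uniq _) rl.
rewrite (bigD1 i)//= [X in _ + X]big1 ?addr0; last first.
  move=> j ji; rewrite (bigD1 j)//= eqxx /l (negbTE ji).
  by rewrite mul0r mul0r.
rewrite -shift_prod; congr rate; apply: eq_bigr => a _.
case: eqP => ai; rewrite /l /phi.
  by rewrite ai eqxx mul1r addn1.
by rewrite scale0r add0r.
Qed.

Lemma rate_heat_sum_t (H : set R) s x t : 0 <= t -> (forall h, H h -> 0 <= h + t) ->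
  rate H (fun h => heat_sum s (x, h + t)) (heat_sum (dt_list s) (x, t)).
Proof.
move=> t0 Ht; rewrite /heat_sum big_allpairs_dep; apply: rate_sum => kappa.
pose phi (a : 'I_n.+1) h := heat (F a (kappa a)) (x 0 a) (h + t).
pose l a := heat (F a (kappa a + 2)) (x 0 a) t.
have rl a : rate H (phi a) (l a).
  have [M FM] := tower_bounded (tF a) (kappa a).+4.
  exists M => h Hh _; rewrite /phi /l add0r (addrC h) addn2.
  by apply: (heat_quadratic_t (tF a)) => //; rewrite addrC Ht.
have := rate_prod (index_enum_uniq _) rl.
rewrite [X in rate _ _ X -> _](_ : _ =
  \sum_(i <- enum 'I_n.+1) heat_prod (shift_index 2 kappa i) (x, t))//.
rewrite big_enum /=; apply: eq_bigr => j _; rewrite -shift_prod.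
by apply: eq_bigr => a _; rewrite /phi add0r.
Qed.

Lemma continuous_heat_sum s : continuous (heat_sum s).
Proof.
have c1 (a : 'I_n.+1) : continuous (fun z : E * R => (z.1 0 a, z.2)).
  move=> z; apply: (@cvg_pair _ _ _ _ (nbhs (z.1 0 a)) (nbhs z.2)); last exact: cvg_snd.
  have c2 := @continuous_comp _ _ _ fst (fun y : E => y 0 a) z cvg_fst.
  by apply: c2; exact: coord_continuous.
have c3 (k : nat) a : continuous (fun z : E * R => heat (F a k) (z.1 0 a) z.2).
  by move=> z; have := continuous_comp (c1 a z) (@continuous_heat _ _ _ _ (tF a) k (z.1 0 a, z.2)).
apply: continuous_big_sum => kappa.
by apply: (continuous_big_prod _ (f := fun a z => heat (F a (kappa a)) (z.1 0 a) z.2)).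
Qed.


(** * Derivatives of heat sums on the cylinder *)

Lemma unit_vec_coord (i a : 'I_n.+1) : @unit_vec R n i 0 a = (a == i)%:R.
Proof. by rewrite mxE eqxx eq_sym. Qed.

Lemma closed_half_space_add i x h : 0 <= h -> closed_half_space x ->
  closed_half_space (h *: unit_vec i + x).
Proof.
rewrite /closed_half_space /= => h0 x0; rewrite mxE [in X in X + _]mxE unit_vec_coord.
by rewrite addr_ge0// mulr_ge0.
Qed.

Lemma cylinderP T x t : cylinder T (x, t) <-> closed_half_space x /\ 0 <= t <= T.
Proof. by rewrite /cylinder /= in_itv. Qed.

Lemma st_dir_x i h x t : h *: @st_dir R n (Some i) + (x, t) = (h *: unit_vec i + x, t).
Proof. by apply: injective_projections => //=; rewrite scaler0 add0r. Qed.

Lemma st_dir_t h x t : h *: @st_dir R n None + (x, t) = (x, h + t).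
Proof.
by apply: injective_projections => /=; rewrite ?scaler0 ?add0r// /GRing.scale /= mulr1.
Qed.

Lemma derive_heat_sum_x T i s f z :
  (forall b, cylinder T b -> f b = heat_sum s b) -> cylinder T z ->
  derivable_in (cylinder T) (st_dir (Some i)) f z /\
  derive_in (cylinder T) (st_dir (Some i)) f z = heat_sum (dx_list i s) z.
Proof.
move=> fs; case: z => x t xt; have [x0 t0] := (cylinderP T x t).1 xt.
apply: (@derive_in_rate _ _ _ _ (heat_sum s)) => // [e e0|].
  exists (e / 2); rewrite gt_eqF ?divr_gt0// gtr0_norm ?divr_gt0//; split=> //.
    by rewrite ltr_pdivrMr// ltr_pMr// ltr1n.
  rewrite st_dir_x; apply/cylinderP; split=> //.
  by apply: closed_half_space_add => //; rewrite divr_ge0// ltW.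
apply: eq_rate (rate_heat_sum_x _ i s x t) => [h _|]; by rewrite st_dir_x.
Qed.

Lemma derive_heat_sum_t T s f z : 0 < T ->
  (forall b, cylinder T b -> f b = heat_sum s b) -> cylinder T z ->
  derivable_in (cylinder T) (st_dir None) f z /\
  derive_in (cylinder T) (st_dir None) f z = heat_sum (dt_list s) z.
Proof.
move=> T0 fs; case: z => x t xt; have [x0 /andP[t0 tT]] := (cylinderP T x t).1 xt.
apply: (@derive_in_rate _ _ _ _ (heat_sum s)) => // [e e0|].
  have e2 : 0 < e / 2 by rewrite divr_gt0.
  have ee : e / 2 < e by rewrite ltr_pdivrMr// ltr_pMr// ltr1n.
  (* Increments go forward in time before [T] and backward at [T]; both stay in the cylinder. *)
  have [tltT|Tlet] := ltP t T.
    pose h := Num.min (e / 2) (T - t).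
    have h0 : 0 < h by rewrite lt_min e2 subr_gt0.
    exists h; rewrite gt_eqF// gtr0_norm//; split=> //.
      by rewrite (le_lt_trans _ ee)// ge_min lexx.
    rewrite st_dir_t; apply/cylinderP; split=> //.
    rewrite addr_ge0 ?(ltW h0)//= -lerBrDr.
    by rewrite ge_min lexx orbT.
  pose h := Num.min (e / 2) T.
  have h0 : 0 < h by rewrite lt_min e2 T0.
  exists (- h); rewrite oppr_eq0 gt_eqF// normrN gtr0_norm//; split=> //.
    by rewrite (le_lt_trans _ ee)// ge_min lexx.
  rewrite st_dir_t; apply/cylinderP; split=> //.
  have hT : h <= T by rewrite ge_min lexx orbT.
  by apply/andP; split; lra.
apply: eq_rate (rate_heat_sum_t s x t0 _) => [h _||h].
- by rewrite st_dir_t.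
- by rewrite st_dir_t.
- by rewrite /= st_dir_t => /cylinderP[_ /andP[]].
Qed.

Lemma smooth_heat_sum T s : 0 < T -> smooth_in st_dir (cylinder T) (heat_sum s).
Proof.
move=> T0; apply: (@smooth_in_closed_class _ _ _ _ _ (fun g => exists s, g = heat_sum s)).
- by move=> _ [s' ->]; exact: continuous_heat_sum.
- move=> _ [i|] [s' ->].
    exists (heat_sum (dx_list i s')); first by exists (dx_list i s').
    by move=> g a; exact: derive_heat_sum_x.
  exists (heat_sum (dt_list s')); first by exists (dt_list s').
  by move=> g a; exact: derive_heat_sum_t.
- by exists s.
Qed.

Lemma smooth_initial s : smooth_in unit_vec closed_half_space (fun x => heat_sum s (x, 0)).
Proof.
apply: (@smooth_in_closed_class _ _ _ _ _ (fun g => exists s, g = fun x => heat_sum s (x, 0))).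
- move=> _ [s' ->] x.
  have c1 : {for x, continuous (fun x : E => (x, 0 : R))}.
    move=> A [[B C] [/= HB HC] BC]; apply: filterS HB => y By.
    by apply: BC; split => //=; exact: nbhs_singleton HC.
  by have := continuous_comp c1 (@continuous_heat_sum s' (x, 0)).
- move=> _ i [s' ->].
  exists (fun x => heat_sum (dx_list i s') (x, 0)); first by exists (dx_list i s').
  move=> f x fs x0.
  apply: (@derive_in_rate _ _ _ _ (fun x => heat_sum s' (x, 0))) => // [e e0|].
    exists (e / 2); rewrite gt_eqF ?divr_gt0// gtr0_norm ?divr_gt0//; split=> //.
      by rewrite ltr_pdivrMr// ltr_pMr// ltr1n.
    by apply: closed_half_space_add => //; rewrite divr_ge0// ltW.
  exact: rate_heat_sum_x.
- by exists s.
Qed.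

Lemma partial_x_iter T i j kappa f :
  (forall b, cylinder T b -> f b = heat_prod kappa b) ->
  forall b, cylinder T b -> iter j (partial_x T i) f b = heat_prod (shift_index j kappa i) b.
Proof.
move=> fk; elim: j => [|j IH] b Tb.
  by rewrite /= fk//; congr heat_prod; apply/ffunP => a; rewrite ffunE mul0n addn0.
have {}IH b' : cylinder T b' -> iter j (partial_x T i) f b' = heat_sum [:: shift_index j kappa i] b'.
  by move=> Tb'; rewrite heat_sum1; exact: IH.
have [_ E1] := derive_heat_sum_x i IH Tb; rewrite iterS; apply: etrans E1 _.
by rewrite heat_sum1; congr heat_prod; apply/ffunP => a; rewrite !ffunE mul1n mulSnr addnA.
Qed.

Lemma D_x_heat_prod T k : forall b, cylinder T b ->
  D_x T k (heat_prod [ffun=> 0%N]) b = heat_prod k b.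
Proof.
move=> b Tb.
(* Induction on the coordinates already treated: those outside [u] still have order zero. *)
suff H (u : seq 'I_n.+1) : uniq u -> forall b, cylinder T b ->
   foldr (fun i W => iter (k i) (partial_x T i) W) (heat_prod [ffun=> 0%N]) u b =
   heat_prod [ffun a => (k a * (a \in u))%N] b.
  rewrite /D_x H ?enum_uniq//; congr heat_prod; apply/ffunP => a.
  by rewrite ffunE mem_enum muln1.
elim: u => [_|i u IH /= /andP[iu uu]] {b Tb} b Tb.
  by congr heat_prod; apply/ffunP => a; rewrite !ffunE muln0.
rewrite (partial_x_iter i (k i) (IH uu))//; congr heat_prod; apply/ffunP => a.
rewrite !ffunE inE; have [->|ai] := eqVneq a i; last by rewrite muln0 addn0.
by rewrite (negbTE iu) muln0 muln1.
Qed.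

Lemma D_tx_heat_prod T iota k : 0 < T -> forall b, cylinder T b ->
  D_tx T iota k (heat_prod [ffun=> 0%N]) b = heat_sum (iter iota dt_list [:: k]) b.
Proof.
move=> T0; rewrite /D_tx; elim: iota => [|j IH] b Tb.
  by rewrite /= heat_sum1 D_x_heat_prod.
by rewrite !iterS; have [_] := derive_heat_sum_t T0 IH Tb.
Qed.

(** Time derivatives change orders by 2 at a time, so the parity that makes normal derivatives
    vanish on the boundary is kept. *)
Lemma iter_dt_list iota k kappa : kappa \in iter iota dt_list [:: k] ->
  forall a, (kappa a <= k a + 2 * iota)%N /\ odd (kappa a) = odd (k a).
Proof.
elim: iota kappa => [|j IH] kappa /=; first by rewrite inE => /eqP -> a; lia.
move=> /allpairsP[[mu i] [/= muj _ ->]] a; rewrite ffunE.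
have [h1 h2] := IH _ muj a; rewrite oddD oddM /= addbF h2; split => //.
by case: (a == i); lia.
Qed.

Lemma size_iter_dt_list iota k : size (iter iota dt_list [:: k]) = (n.+1 ^ iota)%N.
Proof.
elim: iota => [//|j IH] /=.
by rewrite /dt_list size_allpairs IH size_enum_ord expnSr.
Qed.

Lemma heat_sum_bound iota k C z :
  (forall a j (w : R), (j <= k a + 2 * iota)%N -> `|F a j w| <= C) ->
  `|heat_sum (iter iota dt_list [:: k]) z| <= (n.+1 ^ iota)%:R * C ^+ n.+1.
Proof.
move=> FC; rewrite -(size_iter_dt_list iota k) /heat_sum.
rewrite (le_trans (ler_norm_sum _ _ _))//.
set u := iter _ _ _.
have H kappa : kappa \in u -> `|heat_prod kappa z| <= C ^+ n.+1.
  move=> ku; rewrite normr_prod -[X in _ ^+ X]card_ord -prodr_const.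
  apply: ler_prod => a _; rewrite normr_ge0 /=.
  apply: (heat_bound (tF a)) => y; apply: FC.
  by have [] := iter_dt_list ku a.
elim: u H => [_|kappa u IH H] /=; first by rewrite big_nil mul0r.
rewrite big_cons -natr1 mulrDl mul1r addrC lerD//; last by apply: H; rewrite mem_head.
by apply: IH => mu mu_u; apply: H; rewrite inE mu_u orbT.
Qed.

Lemma heat_sum_odd_eq0 iota k x t (a : 'I_n.+1) : odd (k a) ->
  (forall j, odd j -> heat (F a j) (x 0 a) t = 0) ->
  heat_sum (iter iota dt_list [:: k]) (x, t) = 0.
Proof.
move=> ok F0; rewrite /heat_sum big_seq big1// => kappa /iter_dt_list /(_ a)[_ ka].
by rewrite /heat_prod (bigD1 a)//= F0 ?ka// mul0r.
Qed.

Lemma heat_prod_initial kappa x : heat_prod kappa (x, 0) = \prod_a F a (kappa a) (x 0 a).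
Proof. by apply: eq_bigr => a _; rewrite heat0. Qed.

Lemma heat_equation T z : 0 < T -> cylinder T z ->
  partial_t T (heat_prod [ffun=> 0%N]) z = laplacian T (heat_prod [ffun=> 0%N]) z.
Proof.
move=> T0 Tz; rewrite -heat_sum1.
have [_ E1] := derive_heat_sum_t T0 (fun b _ => erefl (heat_sum [:: [ffun=> 0%N]] b)) Tz.
apply: etrans E1 _; rewrite /laplacian /heat_sum /dt_list /= cats0 big_map big_enum /=.
apply: eq_bigr => i _; apply/esym.
have E2 b : cylinder T b -> partial_x T i (heat_sum [:: [ffun=> 0%N]]) b =
    heat_sum (dx_list i [:: [ffun=> 0%N]]) b.
  by move=> Tb; have [] := derive_heat_sum_x i (fun b _ => erefl (heat_sum [:: [ffun=> 0%N]] b)) Tb.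
have [_ E3] := derive_heat_sum_x i E2 Tz.
apply: etrans E3 _; rewrite /= heat_sum1; congr heat_prod.
by apply/ffunP => a; rewrite !ffunE !add0n mul1n mulSn mul1n.
Qed.

End HeatProduct.

(** * The proposition *)

Lemma leq_l1_norm n (k : @multi_index n) a : (k a <= l1_norm k)%N.
Proof. by rewrite /l1_norm (bigD1 a)//= leq_addr. Qed.

(** Passes from supports in boxes, natural for products, to Euclidean balls. *)
Lemma enorm_lt_box {R : realType} n (x : 'rV[R]_n.+1) e : 0 < e ->
  (forall a, `|x 0 a| < e / n.+1%:R) -> enorm x < e.
Proof.
move=> e0 xe; rewrite /enorm -[ltRHS]ger0_norm ?ltW// -sqrtr_sqr ltr_sqrt ?exprn_gt0//.
have n0 : 0 < n.+1%:R :> R by rewrite ltr0n.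
apply: (@lt_le_trans _ _ (\sum_(a < n.+1) (e / n.+1%:R) ^+ 2)).
  apply: ltr_sum; first by apply/hasP; exists ord0 => //; rewrite mem_index_enum.
  by move=> a _; rewrite -real_normK ?num_real// ltr_pXn2r// nnegrE ltW// divr_gt0.
rewrite sumr_const card_ord -[leLHS]mulr_natr.
rewrite (_ : _ * _ = e ^+ 2 / n.+1%:R); last by field; rewrite gt_eqF.
by rewrite ler_pdivrMr// ler_peMr ?ler1n// sqr_ge0.
Qed.

Unset Implicit Arguments.

Theorem proposition2p13 (R : realType) (n l : nat)
    (p : 'I_l -> 'rV[R]_n.+1) (d : R) (N0 : nat)
    (n_ge2 : (2 <= n.+1)%N) (l_gt0 : (0 < l)%N)
    (p_distinct : injective p)
    (p_boundary : forall i, half_space_boundary (p i))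
    (d_gt0 : 0 < d)
    (d_small : forall i j, i != j -> d < 4^-1 * enorm (p i - p j)) :
  exists2 C : R, 0 < C &
  \forall T \near 0^'+,
  exists (V : 'I_l -> @multi_index n -> 'rV[R]_n.+1 * R -> R)
         (V0 : 'I_l -> @multi_index n -> 'rV[R]_n.+1 -> R),
  forall (i : 'I_l) (m : @multi_index n),
    (l1_norm m <= N0)%N -> ~~ odd (m ord_max) ->
    (smooth_in st_dir (cylinder T) (V i m) /\
     heat_neumann_solution T (V0 i m) (V i m)) /\
    [/\ smooth_in unit_vec closed_half_space (V0 i m) /\
        (forall x, closure (half_space `\` half_ball (p i) (2 * d)) x ->
           V0 i m x = 0),
        forall x t (iota : nat) (k : @multi_index n),
          half_space_boundary x -> 0 <= t <= T -> odd (k ord_max) ->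
          D_tx T iota k (V i m) (x, t) = 0,
        forall (j : 'I_l) (k : @multi_index n), (l1_norm k <= N0)%N ->
          D_x T k (V i m) (p j, T) = (m == k)%:R * (p i == p j)%:R
      & forall (iota : nat) (k : @multi_index n),
          (2 * iota + l1_norm k <= N0)%N ->
          (sup_norm (half_space `*` `[0%R, T]) (D_tx T iota k (V i m))
             <= C%:E)%E].
Proof.
(* With this half-width, the box of half-width [2 * r] about [p i] lies in the Euclidean ball of
   radius [2 * d]. *)
pose r := d / n.+1%:R.
have r0 : 0 < r by rewrite divr_gt0// ltr0n.
(* Along coordinate [a], jets must vanish only at coordinates of other points that differ from that
   of [p i]. In the normal coordinate there are none. *)
pose bs i a := [seq b <- [seq p j 0 a | j <- enum 'I_l] | b != p i 0 a].
have mem_bs i j a : (p j 0 a \in bs i a) = (p j 0 a != p i 0 a).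
  rewrite mem_filter andb_idr// => _.
  by apply/mapP; exists j => //; rewrite mem_enum.
have bs_max i : bs i ord_max = [::].
  apply/eqP; rewrite -size_eq0 size_filter -leqn0 leqNgt -has_count.
  apply/hasPn => b /mapP[j _ ->]; apply/negPn/eqP.
  by rewrite (p_boundary i) (p_boundary j).
pose data i a M T m G := [/\ cc_tower (p i 0 a) r G,
    forall k x, (k <= N0)%N -> `|G k x| <= M,
    forall k, (k <= N0)%N -> heat (G k) (p i 0 a) T = (k == m)%:R,
    forall b k, b \in bs i a -> (k <= N0)%N -> heat (G k) b T = 0 &
    bs i a = [::] -> ~~ odd m -> forall k t, odd k -> heat (G k) (p i 0 a) t = 0].
(* One constant encodes both the derivative bound [M] and the time threshold [1 / M], so both are
   made uniform at once. *)
pose Q (u : 'I_l * 'I_n.+1) (M : R) := 0 < M /\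
  forall T (m : nat), 0 < T -> T * M < 1 -> (m <= N0)%N -> exists G, data u.1 u.2 M T m G.
have [| |M0 HM] := @exists_uniform_bound R _ Q (enum {: 'I_l * 'I_n.+1}).
- move=> u x y xy [x0 H]; split; first exact: lt_le_trans xy.
  move=> T m T0 Ty mN; have [|G [h1 h2 h3 h4 h5]] := H T m T0 _ mN.
    by apply: le_lt_trans Ty; rewrite ler_wpM2l// ltW.
  by exists G; split=> // k z kN; apply: le_trans xy; exact: h2.
- move=> [i a] _.
  have [|T0 [C [T00 H]]] := @exists_one_dim_data R (p i 0 a) r (bs i a) N0 r0.
    by move=> b; rewrite mem_filter => /andP[].
  pose M := Num.max C T0^-1.
  have M0 : 0 < M by rewrite lt_max invr_gt0 T00 orbT.
  exists M; split=> // T m T1 TM mN.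
  have TT0 : 0 < T < T0.
    rewrite T1 /= -[T0]invrK -(mul1r T0^-1^-1) ltr_pdivlMr ?invr_gt0//.
    by apply: le_lt_trans TM; rewrite ler_wpM2l ?(ltW T1)// le_max lexx orbT.
  have [G [h1 h2 h3 h4 h5]] := H T m TT0 mN.
  exists G; split=> // k z kN; apply: le_trans (h2 k z kN) _.
  by rewrite le_max lexx.
pose M := Num.max 1 M0.
have M1 : 0 < M by rewrite lt_max ltr01.
(* At most [n.+1 ^ N0] products arise from [iota <= N0] time derivatives, each with [n.+1] factors
   bounded by [M]. *)
exists ((n.+1 ^ N0)%:R * M ^+ n.+1).
  by rewrite mulr_gt0 ?exprn_gt0// ltr0n expn_gt0.
near=> T.
have T0 : 0 < T by near: T; exact: nbhs_right_gt.
have TM : T * M < 1.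
  rewrite -ltr_pdivlMr// mul1r.
  by near: T; apply: nbhs_right_lt; rewrite invr_gt0.
(* The factor along [a] depends on [m] through [m a] only. Orders above [N0] receive the zero
   function as a default. *)
have /choice[G HG] : forall u : 'I_l * 'I_n.+1 * nat, exists G,
    (u.2 <= N0)%N -> data u.1.1 u.1.2 M T u.2 G.
  move=> [[i a] m]; have [mN|mN] := leqP m N0; last by exists (fun _ _ => 0).
  have [M00 H] := HM (i, a) (mem_enum _ _).
  have [|G [h1 h2 h3 h4 h5]] := H T m T0 _ mN.
    by apply: le_lt_trans TM; rewrite ler_wpM2l ?(ltW T0)// le_max lexx orbT.
  exists G => _; split=> // k z kN; apply: le_trans (h2 k z kN) _.
  by rewrite le_max lexx orbT.
pose F i (m : @multi_index n) a := G (i, a, m a).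
exists (fun i m => heat_prod (F i m) [ffun=> 0%N]).
exists (fun i m x => heat_prod (F i m) [ffun=> 0%N] (x, 0)).
move=> i m mN m_even.
have HF a : data i a M T (m a) (F i m a).
  by apply: (HG (i, a, m a)); exact: leq_trans (leq_l1_norm m a) mN.
have tF a : cc_tower (p i 0 a) r (F i m a) by have [] := HF a.
have F_odd x k t : half_space_boundary x -> odd k ->
    heat (F i m ord_max k) (x 0 ord_max) t = 0.
  move=> x0 ok; have [_ _ _ _ h] := HF ord_max.
  by rewrite (_ : x 0 ord_max = p i 0 ord_max) ?h ?bs_max// x0 (p_boundary i).
have closed x : half_space x -> closed_half_space x by exact: ltW.
have bdry x : half_space_boundary x -> closed_half_space x.
  by rewrite /half_space_boundary /closed_half_space /= => ->.
split; first split.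
- by rewrite -heat_sum1; exact: (smooth_heat_sum tF).
- split=> [x t x0 /andP[t0 tT]|x t x0 /andP[t0 tT]|//].
    apply: (heat_equation tF) => //; apply/cylinderP; split; first exact: closed.
    by rewrite (ltW t0).
  have xt : cylinder T (x, t) by apply/cylinderP; split; [exact: bdry|rewrite (ltW t0)].
  have [_ E1] := derive_heat_sum_x tF ord_max
    (fun b _ => erefl (heat_sum (F i m) [:: [ffun=> 0%N]] b)) xt.
  rewrite -heat_sum1; apply/eqP; rewrite oppr_eq0; apply/eqP; apply: etrans E1 _.
  rewrite /= heat_sum1 /heat_prod (bigD1 ord_max)//= F_odd ?mul0r//.
  by rewrite !ffunE eqxx.
split.
- split; first by have := smooth_initial tF [:: [ffun=> 0%N]]; rewrite heat_sum1.
  (* If the datum is nonzero at [x], every factor is, so [x] is in the box of half-width [r]. A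
     point [y] of the complement within [r] of [x] then lies in the excluded ball. *)
  move=> x clx; rewrite heat_prod_initial; apply: contrapT => /eqP Vx0.
  have xr a : `|(x - p i) 0 a| < r.
    rewrite !mxE ltNge; apply: contra Vx0 => rx.
    by rewrite (bigD1 a)//= (tF a).2 ?mul0r// ffunE.
  have [y [[y0 yB] xy]] := clx _ (nbhsx_ballx x r r0).
  apply: yB; split=> //; apply: enorm_lt_box; first by rewrite mulr_gt0.
  move=> a; rewrite -mulrA -/r.
  have yx : `|(x - y) 0 a| < r by move: xy => [_ /(_ 0 a)]; rewrite !mxE.
  rewrite (_ : (y - p i) 0 a = (x - p i) 0 a - (x - y) 0 a); last by rewrite !mxE; ring.
  by rewrite (le_lt_trans (ler_normB _ _))// mulr_natl mulr2n ltrD.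
- move=> x t iota k x0 tT ok.
  have xt : cylinder T (x, t) by apply/cylinderP; split; [exact: bdry|].
  rewrite (D_tx_heat_prod tF)//; apply: heat_sum_odd_eq0 ok _ => j oj.
  exact: F_odd.
- move=> j k kN; rewrite (D_x_heat_prod tF); last first.
    by apply/cylinderP; split; [exact: bdry|rewrite lexx ltW].
  have kaN a : (k a <= N0)%N by exact: leq_trans (leq_l1_norm k a) kN.
  rewrite /heat_prod /=.
  have [pij|pij] := eqVneq (p i) (p j).
    rewrite mulr1 -pij.
    rewrite (eq_bigr (fun a => (k a == m a)%:R)) => [|a _]; last first.
      by have [_ _ h _ _] := HF a; rewrite h.
    have [->|mk] := eqVneq m k; first by rewrite big1// => a _; rewrite eqxx.
    have [a ka] : exists a, k a != m a.
      apply: contrapT => H; move/eqP: mk; apply; apply/ffunP => a.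
      by apply/eqP; rewrite eq_sym; apply/negPn/negP => ka; apply: H; exists a.
    by rewrite (bigD1 a)//= (negbTE ka) mul0r.
  (* Distinct points differ in some coordinate [a], and there the vanishing factor kills the
     product. *)
  have [a pa] : exists a, p j 0 a != p i 0 a.
    apply: contrapT => H; move/eqP: pij; apply; apply/rowP => a.
    by apply/eqP; rewrite eq_sym; apply/negPn/negP => pa; apply: H; exists a.
  rewrite mulr0 (bigD1 a)//=; have [_ _ _ h _] := HF a.
  by rewrite h ?mul0r// mem_bs.
- move=> iota k kN; apply: ge_ereal_sup => _ [[x t] [/= x0 tT] <-].
  move: tT; rewrite /= in_itv /= => tT.
  rewrite lee_fin (D_tx_heat_prod tF)//; last by apply/cylinderP; split => //; exact: closed.
  have iN : (iota <= N0)%N by lia.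
  apply: le_trans (heat_sum_bound tF _ _) _.
    move=> a j w jN; have [_ h _ _ _] := HF a; apply: h.
    by apply: leq_trans jN _; have := leq_l1_norm k a; lia.
  by rewrite ler_wpM2r ?exprn_ge0 ?(ltW M1)// ler_nat leq_pexp2l.
Unshelve. all: by end_near.
Qed.
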